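(* The Hausdorff dimension of the Julia set $\mathcal J_{\mathcal V}$ associated to the Vicsek set is $$\dim_H(\mathcal J_{\mathcal V})=0.49195457005266\ldots,$$ accurate to the number of decimals stated, i.e. $0.49195457005266\le\dim_H(\mathcal J_{\mathcal V})\le0.49195457005267$.
   Context: Let $R_{\mathcal V}:[-1,0]\to\mathbb R$, $R_{\mathcal V}(z)=z(6z+3)(6z+5)$. It has three inverse branches $S_{1,\mathcal V},S_{2,\mathcal V},S_{3,\mathcal V}:[-1,0]\to[-1,0]$ (so $R_{\mathcal V}\circ S_{j,\mathcal V}=\mathrm{id}$ on $[-1,0]$, and their images together give $R_{\mathcal V}^{-1}([-1,0])$), given explicitly by $$S_{1,\mathcal V}(x)=\tfrac1{36}\left(i(\sqrt3+i)t(x)-\tfrac{19(1+i\sqrt3)}{t(x)}-16\right),\quad S_{2,\mathcal V}(x)=\tfrac1{36}\left(-i(\sqrt3-i)t(x)-\tfrac{19(1-i\sqrt3)}{t(x)}-16\right),$$ $$S_{3,\mathcal V}(x)=\tfrac1{18}\left(t(x)+\tfrac{19}{t(x)}-8\right),\qquad t(x)=\left(9(81x^2+56x-75)^{1/2}+81x+28\right)^{1/3},$$ with principal branches of the roots. The Julia set $\mathcal J_{\mathcal V}\subset[-1,0]$ is the smallest non-empty closed set such that $\mathcal J_{\mathcal V}=\bigcup_{j=1}^3S_{j,\mathcal V}(\mathcal J_{\mathcal V})$. $\dim_H$ denotes the Hausdorff dimension. *)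

(* Defs.v *)
From HB Require Import structures.
From mathcomp Require Import all_boot all_order all_algebra ring lra.
From mathcomp Require Import all_classical all_reals all_analysis.
From mathcomp Require Export complex.
Set Implicit Arguments.
Unset Strict Implicit.
Unset Printing Implicit Defensive.
Import Order.TTheory GRing.Theory Num.Theory.
Import numFieldNormedType.Exports.
Local Open Scope classical_set_scope.
Local Open Scope ring_scope.
Local Open Scope complex_scope.

(* decimal [:: d1; ...; dn] is the number 0.d1...dn in base ten.  (A literal such as
   49195457005266 would be parsed in unary.) *)
Definition decimal (R : realType) (ds : seq nat) : R :=
  \sum_(i < size ds) (nth 0%N ds i)%:R / 10 ^+ i.+1.

Section Hausdorff.
Context {R : realType}.
Local Open Scope ereal_scope.

(* The diameter of the empty set is -oo here; see hausdorff_weight. *)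
Definition diam (U : set R) : \bar R :=
  ereal_sup [set `|p.1 - p.2|%:E | p in U `*` U].

(* (diam U)^s, with the usual conventions for s = 0: the empty set has weight 0
   and a singleton has weight 0^0 = 1. *)
Definition hausdorff_weight (s : R) (U : set R) : \bar R :=
  if U == set0 then 0 else diam U `^ s.

Definition delta_cover (delta : R) (A : set R) (U : (set R)^nat) : Prop :=
  A `<=` \bigcup_n U n /\ forall n, diam (U n) <= delta%:E.

Definition hausdorff_premeasure (s delta : R) (A : set R) : \bar R :=
  ereal_inf [set \sum_(0 <= n <oo) hausdorff_weight s (U n)
            | U in delta_cover delta A].

(* The premeasure is nonincreasing in delta, so this supremum is its limit as
   delta tends to 0. *)
Definition hausdorff_measure (s : R) (A : set R) : \bar R :=
  ereal_sup [set hausdorff_premeasure s delta A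
            | delta in [set delta : R | (0 < delta)%R]].

Definition hausdorff_dim (A : set R) : \bar R :=
  ereal_inf [set s%:E | s in [set s : R | (0 <= s)%R /\
                                          hausdorff_measure s A = 0]].

End Hausdorff.

Section PrincipalRoots.
Context {R : realType}.
Implicit Type z : R[i].

Definition cabs (z : R[i]) : R :=
  Num.sqrt (complex.Re z ^+ 2 + complex.Im z ^+ 2).

(* The principal argument, in ]-pi, pi]; its value at 0 is irrelevant. *)
Definition carg (z : R[i]) : R :=
  let a := acos (complex.Re z / cabs z) in
  if 0 <= complex.Im z then a else - a.

(* The principal branch of z^(1/n), for n > 0. *)
Definition croot (n : nat) (z : R[i]) : R[i] :=
  (cabs z `^ n%:R^-1)%:C *
  (cos (carg z / n%:R) +i* sin (carg z / n%:R)).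

Lemma cabs_ge0 z : 0 <= cabs z.
Proof. exact: sqrtr_ge0. Qed.

Lemma sqr_cabs z : cabs z ^+ 2 = complex.Re z ^+ 2 + complex.Im z ^+ 2.
Proof. by rewrite sqr_sqrtr// addr_ge0// sqr_ge0. Qed.

Let carg_bound z : 0 < cabs z -> -1 <= complex.Re z / cabs z <= 1.
Proof.
move=> z0; have e2 := sqr_cabs z.
rewrite -ler_norml normrM normfV (gtr0_norm z0) ler_pdivrMr// mul1r.
by rewrite -(@ler_pXn2r _ 2)// ?nnegrE ?cabs_ge0// real_normK ?num_real// e2 lerDl sqr_ge0.
Qed.

Lemma carg_ge0_lepi z : 0 < cabs z -> 0 <= complex.Im z -> 0 <= carg z <= pi.
Proof.
by move=> z0 i0; rewrite /carg i0 acos_ge0 ?acos_lepi ?carg_bound.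
Qed.

Lemma cargE z : 0 < cabs z ->
  z = (cabs z)%:C * (cos (carg z) +i* sin (carg z)).
Proof.
move=> z0; have z0' : cabs z != 0 by rewrite gt_eqF.
have e2 := sqr_cabs z.
have u1 : (complex.Re z / cabs z) ^+ 2 + (complex.Im z / cabs z) ^+ 2 = 1.
  by rewrite !expr_div_n -mulrDl -e2 divff// expf_neq0.
have b := carg_bound z0.
have sE : sin (acos (complex.Re z / cabs z)) = `|complex.Im z| / cabs z.
  rewrite sin_acos// -u1 addrAC subrr add0r sqrtr_sqr normrM normfV.
  by rewrite (gtr0_norm z0).
have H : z = (cabs z)%:C *
    ((complex.Re z / cabs z) +i* (complex.Im z / cabs z)).
  move: (cabs z) z0' => r r0; apply/eqP; rewrite eq_complex/= !mul0r subr0 addr0.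
  by rewrite ![r * _]mulrC !divfK// !eqxx.
rewrite /carg; case: ifPn => [i0|]; last rewrite -ltNge => i0.
- rewrite sE acosK ?in_itv// ger0_norm//; exact: H.
- rewrite cosN sinN sE acosK ?in_itv// ltr0_norm// mulNr opprK; exact: H.
Qed.

Lemma expcis (a : R) n :
  (cos a +i* sin a) ^+ n = cos (n%:R * a) +i* sin (n%:R * a) :> R[i].
Proof.
elim: n => [|n IH]; first by rewrite expr0 mul0r cos0 sin0.
rewrite exprS IH -natr1 mulrDl mul1r cosD sinD; simpc.
by congr (_ +i* _); ring.
Qed.

Lemma croot_expn n z : (0 < n)%N -> 0 < cabs z -> croot n z ^+ n = z.
Proof.
move=> n0 z0; rewrite {2}(cargE z0) /croot exprMn expcis.
have nn : n%:R != 0 :> R by rewrite pnatr_eq0 -lt0n.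
congr (_ * _); last by rewrite mulrC divfK.
rewrite -rmorphXn/= -powR_mulrn ?powR_ge0//= -powRrM mulVf// powRr1//.
exact: ltW.
Qed.

Lemma cabs_croot n z : cabs (croot n z) = cabs z `^ n%:R^-1.
Proof.
rewrite /croot /cabs; simpc => /=.
rewrite -/(cabs z) !exprMn -mulrDr cos2Dsin2 mulr1 sqrtr_sqr ger0_norm//.
exact: powR_ge0.
Qed.

Lemma croot_quadrant n z : (1 < n)%N -> 0 < cabs z -> 0 <= complex.Im z ->
  0 <= complex.Re (croot n z) /\ 0 <= complex.Im (croot n z).
Proof.
move=> n1 z0 /(carg_ge0_lepi z0)/andP[a0 api].
have nn : 2 <= n%:R :> R by rewrite ler_nat.
have a1 : 0 <= carg z / n%:R by rewrite divr_ge0.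
have a2 : carg z / n%:R <= pi / 2.
  by rewrite ler_pdivrMr; have := pi_gt0 R; nra.
rewrite /croot; simpc => /=; split; rewrite mulr_ge0 ?powR_ge0//.
- by apply: cos_ge0_pihalf; rewrite a2 (le_trans _ a1)// oppr_le0 divr_ge0// pi_ge0.
- by apply: sin_ge0_pi; rewrite a1/=; have := pi_gt0 R; lra.
Qed.

End PrincipalRoots.

Section Vicsek.
Context {R : realType}.
Implicit Type x : R.

Definition vicsek_map (z : R) : R := z * (6 * z + 3) * (6 * z + 5).

Definition vicsek_t (x : R) : R[i] :=
  let X := x%:C in
  croot 3 (9 * croot 2 (81 * X ^+ 2 + 56 * X - 75) + 81 * X + 28).

Definition vicsek_branch1C (x : R) : R[i] :=
  let t := vicsek_t x in let r3 := (Num.sqrt 3)%:C in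
  36^-1 * ('i * (r3 + 'i) * t - 19 * (1 + 'i * r3) / t - 16).

Definition vicsek_branch2C (x : R) : R[i] :=
  let t := vicsek_t x in let r3 := (Num.sqrt 3)%:C in
  36^-1 * (- 'i * (r3 - 'i) * t - 19 * (1 - 'i * r3) / t - 16).

Definition vicsek_branch3C (x : R) : R[i] :=
  let t := vicsek_t x in 18^-1 * (t + 19 / t - 8).

(* The three expressions above are real for x in [-1, 0]
   (lemma vicsek_branch_real below), so taking real parts loses nothing. *)
Definition vicsek_branch1 (x : R) : R := complex.Re (vicsek_branch1C x).
Definition vicsek_branch2 (x : R) : R := complex.Re (vicsek_branch2C x).
Definition vicsek_branch3 (x : R) : R := complex.Re (vicsek_branch3C x).

Definition vicsek_invariant (K : set R) : Prop :=
  [/\ K !=set0, closed K, K `<=` `[-1, 0] &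
      K = vicsek_branch1 @` K `|` vicsek_branch2 @` K `|` vicsek_branch3 @` K].

(* [smallest C G] is the intersection of all members of C containing G. By lemma
   vicsek_julia_invariant below, vicsek_julia itself satisfies vicsek_invariant,
   so it is the least such set. *)
Definition vicsek_julia : set R := smallest vicsek_invariant set0.

Let linC (p q c d : R) : p%:C * (c +i* d) + q%:C = (p * c + q) +i* (p * d).
Proof. by simpc. Qed.

Let sqr_real (X c d : R) : X < 0 -> (c +i* d) ^+ 2 = X%:C ->
  c = 0 /\ d ^+ 2 = - X.
Proof.
move=> X0; rewrite expr2; simpc => -[e1 e2].
have cd : c * d = 0 by nra.
have c0 : c = 0.
  by move: cd => /eqP; rewrite mulf_eq0 => /orP[/eqP//|/eqP d0]; nra.
by split=> //; move: e1; rewrite c0; lra.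
Qed.

Lemma vicsek_tP x : x \in `[-1, 0] -> exists a b : R,
  [/\ vicsek_t x = a +i* b, a ^+ 2 + b ^+ 2 = 19,
      a ^+ 3 - 3 * a * b ^+ 2 = 81 * x + 28 & 2 <= a].
Proof.
rewrite in_itv/= => /andP[x1 x0]; rewrite /vicsek_t.
set r := croot 2 _.
have XE : 81 * x%:C ^+ 2 + 56 * x%:C - 75 = (81 * x ^+ 2 + 56 * x - 75)%:C :> R[i].
  by rewrite !(rmorphB, rmorphD, rmorphM, rmorphXn, rmorph_nat)/=.
have X0 : 81 * x ^+ 2 + 56 * x - 75 < 0 by nra.
have rX : r ^+ 2 = (81 * x ^+ 2 + 56 * x - 75)%:C.
  rewrite /r XE croot_expn// /cabs/= expr0n addr0 sqrtr_sqr normr_gt0.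
  by rewrite lt_eqF.
have d0 : 0 <= complex.Im r.
  rewrite /r XE; apply: (croot_quadrant (n := 2) _ _ _).2 => //=.
  by rewrite /cabs/= expr0n addr0 sqrtr_sqr normr_gt0 lt_eqF.
case: r rX d0 => c d /(sqr_real X0)[c0 d2] /= d0.
have {}d0 : 0 < d.
  by rewrite lt_neqAle d0 andbT eq_sym -sqrf_eq0 d2 oppr_eq0 lt_eqF.
have wE : 9 * (c +i* d) + 81 * x%:C + 28 = (81 * x + 28) +i* (9 * d).
  transitivity (9%:C * (c +i* d) + (81 * x + 28)%:C).
    by rewrite -addrA !(rmorphD, rmorphM, rmorph_nat).
  by rewrite linC c0 mulr0 add0r.
rewrite {}wE.
set w := _ +i* _.
have w2 : cabs w ^+ 2 = 19 ^+ 3.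
  by rewrite sqr_cabs/= exprMn d2; ring.
have w0 : 0 < cabs w.
  by rewrite lt_neqAle cabs_ge0 andbT eq_sym -sqrf_eq0 w2; lra.
have t3 : croot 3 w ^+ 3 = w by exact: croot_expn.
have tn : cabs (croot 3 w) ^+ 2 = 19.
  apply/eqP; rewrite -(@eqrXn2 _ 3)// ?sqr_ge0// -w2 exprAC cabs_croot.
  by rewrite -[X in X ^+ 2]powR_mulrn ?powR_ge0// -powRrM mulVf// powRr1// ltW.
have wq : 0 <= complex.Re (croot 3 w) /\ 0 <= complex.Im (croot 3 w).
  by apply: croot_quadrant => //=; rewrite mulr_ge0// ltW.
case: (croot 3 w) t3 tn wq => a b t3; rewrite sqr_cabs/= => tn [a0 b0].
have [t3r t3i] : a ^+ 3 - 3 * a * b ^+ 2 = 81 * x + 28 /\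
                 b * (3 * a ^+ 2 - b ^+ 2) = 9 * d.
  move: t3; rewrite exprS expr2 /w; move: (81 * x + 28) (9 * d) => u v.
  by simpc => -[<- <-]; split; ring.
exists a, b; split => //.
have ba : 0 < 3 * a ^+ 2 - b ^+ 2.
  rewrite ltNge; apply/negP => h.
  suff : b * (3 * a ^+ 2 - b ^+ 2) <= 0 by rewrite t3i; lra.
  exact: mulr_ge0_le0.
rewrite leNgt; apply/negP => a2; nra.
Qed.

Let invC (a b : R) : a ^+ 2 + b ^+ 2 = 19 -> 19 / (a +i* b) = a -i* b.
Proof.
move=> ab.
have e : (a +i* b) * (a -i* b) = 19.
  rewrite -[RHS](rmorph_nat (real_complex R)) -ab; simpc.
  by apply/eqP; rewrite eq_complex/=; apply/andP; split; apply/eqP; ring.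
rewrite -e mulrAC divff ?mul1r//.
apply/eqP => z0; move: e; rewrite z0 mul0r => /eqP.
by rewrite eq_sym pnatr_eq0.
Qed.

Lemma vicsek_branchE x : x \in `[-1, 0] -> exists a b : R,
  [/\ [/\ a ^+ 2 + b ^+ 2 = 19, a ^+ 3 - 3 * a * b ^+ 2 = 81 * x + 28 & 2 <= a],
      vicsek_branch1C x = ((- a - Num.sqrt 3 * b - 8) / 18)%:C,
      vicsek_branch2C x = ((- a + Num.sqrt 3 * b - 8) / 18)%:C &
      vicsek_branch3C x = ((a - 4) / 9)%:C].
Proof.
move=> /vicsek_tP[a [b [tE ab a3 a2]]]; exists a, b.
have /esym r3 : Num.sqrt 3 ^+ 2 = 3 :> R by rewrite sqr_sqrtr.
have inv19 (z : R[i]) : 19 * z / (a +i* b) = z * (a -i* b).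
  by rewrite -(invC ab); ring.
have natE n : n%:R = n%:R%:C :> R[i] by rewrite rmorph_nat.
have invE n : (n%:R)^-1 = (n%:R^-1)%:C :> R[i] by rewrite fmorphV rmorph_nat.
rewrite /vicsek_branch1C /vicsek_branch2C /vicsek_branch3C tE !inv19 (invC ab).
rewrite (invE 36) (invE 18) (natE 16) (natE 8).
have C1 (k m r : R) : k%:C * ('i * (r%:C + 'i) * (a +i* b) -
    (1 + 'i * r%:C) * (a -i* b) - m%:C) = (k * (- 2 * a - 2 * r * b - m))%:C.
  by simpc; apply/eqP; rewrite eq_complex/=; apply/andP; split; apply/eqP; ring.
have C2 (k m r : R) : k%:C * (- 'i * (r%:C - 'i) * (a +i* b) -
    (1 - 'i * r%:C) * (a -i* b) - m%:C) = (k * (- 2 * a + 2 * r * b - m))%:C.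
  by simpc; apply/eqP; rewrite eq_complex/=; apply/andP; split; apply/eqP; ring.
have C3 (k m : R) : k%:C * ((a +i* b) + (a -i* b) - m%:C) = (k * (2 * a - m))%:C.
  by simpc; apply/eqP; rewrite eq_complex/=; apply/andP; split; apply/eqP; ring.
by rewrite C1 C2 C3; split=> //; congr (_%:C); field.
Qed.

Lemma vicsek_branch_real x : x \in `[-1, 0] ->
  [/\ vicsek_branch1C x = (vicsek_branch1 x)%:C,
      vicsek_branch2C x = (vicsek_branch2 x)%:C &
      vicsek_branch3C x = (vicsek_branch3 x)%:C].
Proof.
move=> /vicsek_branchE[a [b [_ e1 e2 e3]]].
by rewrite /vicsek_branch1 /vicsek_branch2 /vicsek_branch3 e1 e2 e3.
Qed.

Lemma vicsek_branchK x : x \in `[-1, 0] ->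
  [/\ vicsek_map (vicsek_branch1 x) = x, vicsek_map (vicsek_branch2 x) = x &
      vicsek_map (vicsek_branch3 x) = x].
Proof.
move=> /vicsek_branchE[a [b [[ab a3 _] e1 e2 e3]]].
rewrite /vicsek_branch1 /vicsek_branch2 /vicsek_branch3 e1 e2 e3/= /vicsek_map.
have r3 : Num.sqrt 3 ^+ 2 = 3 :> R by rewrite sqr_sqrtr.
move: (Num.sqrt 3) r3 => r r3.
have K c : 4 * c ^+ 3 - 57 * c = 81 * x + 28 ->
    (c - 4) / 9 * (6 * ((c - 4) / 9) + 3) * (6 * ((c - 4) / 9) + 5) = x.
  move=> cE; have -> : x = (4 * c ^+ 3 - 57 * c - 28) / 81 by rewrite cE; field.
  by field.
have b2 : b ^+ 2 = 19 - a ^+ 2 by rewrite -ab; ring.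
have E c : c ^+ 2 = 3 ->
    4 * ((- a + c * b) / 2) ^+ 3 - 57 * ((- a + c * b) / 2) = 81 * x + 28.
  move=> c3; rewrite -a3.
  transitivity ((- a ^+ 3 + 3 * a ^+ 2 * (c * b) - 3 * a * (c ^+ 2 * b ^+ 2)
     + c * b * (c ^+ 2 * b ^+ 2)) / 2 - 57 * ((- a + c * b) / 2)); first by field.
  by rewrite c3 b2; field.
have e (c : R) : (- a + c * b - 8) / 18 = ((- a + c * b) / 2 - 4) / 9 by field.
rewrite -mulNr !e; split; apply: K; [apply: E | exact: E |].
- by rewrite sqrrN.
- by rewrite -a3 b2; ring.
Qed.

Lemma vicsek_branch_itv x : x \in `[-1, 0] ->
  [/\ vicsek_branch1 x \in `[-1, 0], vicsek_branch2 x \in `[-1, 0] &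
      vicsek_branch3 x \in `[-1, 0]].
Proof.
move=> x01; have [] := vicsek_branchK x01.
have K (z : R) : vicsek_map z = x -> z \in `[-1, 0].
  move: x01; rewrite !in_itv/= /vicsek_map => /andP[x1 x0] zx.
  rewrite !leNgt; apply/andP; split; apply/negP => h.
    suff : 0 < - (z + 1) * ((6 * z + 3) * (6 * z + 5)) by nra.
    by apply: mulr_gt0; [lra|nra].
  suff : 0 < z * ((6 * z + 3) * (6 * z + 5)) by lra.
  by apply: mulr_gt0; [lra|nra].
by move=> /K-> /K-> /K->.
Qed.

Lemma vicsek_branch3_bound x : x \in `[-1, 0] -> x / 2 <= vicsek_branch3 x <= 0.
Proof.
move=> x01; have [_ _] := vicsek_branch_itv x01.
have [_ _] := vicsek_branchK x01.
have [a [b [[_ _ a2] _ _ e3]]] := vicsek_branchE x01.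
have : - 9 * 2 <= (vicsek_branch3 x + 2 / 9 - 2 / 9) * 81.
  by rewrite /vicsek_branch3 e3/=; lra.
rewrite in_itv/= /vicsek_map; move: (vicsek_branch3 x) => z zb <- /andP[_ z0].
rewrite z0 andbT.
suff : 0 <= - z * ((6 * z + 3) * (6 * z + 5) - 2) by nra.
by apply: mulr_ge0; [lra|nra].
Qed.

Lemma vicsek_branch_surj (z : R) : z \in `[-1, 0] -> vicsek_map z \in `[-1, 0] ->
  [\/ z = vicsek_branch1 (vicsek_map z), z = vicsek_branch2 (vicsek_map z) |
      z = vicsek_branch3 (vicsek_map z)].
Proof.
move=> z01 x01; have [a [b [[ab a3 a2] e1 e2 e3]]] := vicsek_branchE x01.
rewrite /vicsek_branch1 /vicsek_branch2 /vicsek_branch3 e1 e2 e3/=.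
have r3 : Num.sqrt 3 ^+ 2 = 3 :> R by rewrite sqr_sqrtr.
move: (Num.sqrt 3) r3 => r r3.
have b2 : b ^+ 2 = 19 - a ^+ 2 by rewrite -ab; ring.
suff : (z - (- a - r * b - 8) / 18) * (z - (- a + r * b - 8) / 18) *
       (z - (a - 4) / 9) = 0.
  move=> /eqP; rewrite !mulf_eq0 !subr_eq0 -orbA => /or3P[] /eqP ?;
    [exact: Or31|exact: Or32|exact: Or33].
have zE : vicsek_map z = (a ^+ 3 - 3 * a * b ^+ 2 - 28) / 81 by rewrite a3; field.
transitivity (((z + (a + 8) / 18) ^+ 2 - r ^+ 2 * b ^+ 2 / 18 ^+ 2) *
              (z - (a - 4) / 9)); first by field.
rewrite r3.
transitivity ((vicsek_map z - (a ^+ 3 - 3 * a * b ^+ 2 - 28) / 81) / 36).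
  by rewrite b2 /vicsek_map; field.
by rewrite zE subrr mul0r.
Qed.

Lemma vicsek_invariant_ex : exists K : set R, vicsek_invariant K.
Proof.
pose K : set R := \bigcap_n (iter n vicsek_map @^-1` [set` `[-1, 0]]).
have Kitv : K `<=` `[-1, 0] by move=> y /(_ 0%N); exact.
have KS n y : iter n vicsek_map (vicsek_map y) = iter n.+1 vicsek_map y.
  by rewrite -iterSr.
have Kinv y x : y \in `[-1, 0] -> vicsek_map y = x -> K x -> K y.
  move=> y01 yx Kx [_|n _]; first exact: y01.
  by have := Kx n I; rewrite -yx /preimage/= -iterS -KS.
exists K; split.
- exists 0 => n _ /=; suff -> : iter n vicsek_map 0 = 0 :> R.
    by rewrite in_itv/= lexx lerN10.
  by elim: n => //= n ->; rewrite /vicsek_map !mul0r.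
- apply: closed_bigI => n _; apply: closed_comp; last exact: interval_closed.
  move=> x _; elim: n => [|n IH]; first exact: cvg_id.
  have cvm : continuous vicsek_map.
    move=> z; rewrite /vicsek_map; apply: cvgM; [apply: cvgM|].
    + exact: cvg_id.
    + by apply: cvgD; [apply: cvgMr; exact: cvg_id|exact: cvg_cst].
    + by apply: cvgD; [apply: cvgMr; exact: cvg_id|exact: cvg_cst].
  exact: (continuous_comp IH (cvm _)).
- exact: Kitv.
- apply/seteqP; split=> [y Ky|y].
    have y01 := Kitv _ Ky.
    have Kx : K (vicsek_map y) by move=> n _; rewrite /= KS; exact: Ky.
    have [e|e|e] := vicsek_branch_surj y01 (Kitv _ Kx).
    + by left; left; exists (vicsek_map y).
    + by left; right; exists (vicsek_map y).
    + by right; exists (vicsek_map y).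
  move=> [[|]|] [x Kx <-]; have x01 := Kitv _ Kx;
    have [i1 i2 i3] := vicsek_branch_itv x01;
    have [k1 k2 k3] := vicsek_branchK x01; exact: Kinv Kx.
Qed.

Lemma vicsek_invariant0 (K : set R) : vicsek_invariant K -> K 0.
Proof.
move=> [[x Kx] Kcl K01 KE].
pose u n := iter n vicsek_branch3 x.
have Ku n : K (u n).
  by elim: n => //= n IH; rewrite KE; right; exists (u n).
have ub n : - (2^-1) ^+ n <= u n <= 0.
  elim: n => [|n /andP[h1 h2]].
    by rewrite expr0; have := K01 _ Kx; rewrite /= in_itv.
  have /andP[h3 ->] := vicsek_branch3_bound (K01 _ (Ku n)).
  by rewrite andbT (le_trans _ h3)// exprS; lra.
apply: (closed_cvg K Kcl (u_ := u) (F := \oo)); first by near=> n; exact: Ku.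
apply: (@squeeze_cvgr _ _ _ _ (fun n => - (2^-1) ^+ n) (cst 0)).
- by near=> n; exact: ub.
- by rewrite -oppr0; apply: cvgN; apply: cvg_expr; rewrite ger0_norm; lra.
- exact: cvg_cst.
Unshelve. all: by end_near. Qed.

Lemma vicsek_julia_invariant : vicsek_invariant vicsek_julia.
Proof.
have [K0 K0inv] := vicsek_invariant_ex.
have JK (K : set R) : vicsek_invariant K -> vicsek_julia `<=` K.
  by move=> Kinv; apply: smallest_sub.
have [_ _ K001 K0E] := K0inv.
split.
- by exists 0 => K [/vicsek_invariant0].
- by apply: closed_bigI => K [[]].
- by move=> y Jy; apply: K001; exact: (JK _ K0inv).
- apply/seteqP; split=> [y Jy|y].
    have Jx : vicsek_julia (vicsek_map y).
      move=> K [Kinv _]; have := JK _ Kinv _ Jy.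
      have [_ _ K01 KE] := Kinv.
      by rewrite {1}KE => -[[|]|] [x Kx <-];
        have [k1 k2 k3] := vicsek_branchK (K01 _ Kx); rewrite ?k1 ?k2 ?k3.
    have := JK _ K0inv _ Jy.
    by rewrite K0E => -[[|]|] [x /K001 x01 e]; [left; left|left; right|right];
      exists (vicsek_map y) => //; rewrite -e; congr (_ _);
      have [] := vicsek_branchK x01.
  move=> Jy K [Kinv _]; have [_ _ _ ->] := Kinv.
  by move: Jy => [[|]|] [x Jx <-]; have Kx := JK _ Kinv _ Jx;
    [left; left|left; right|right]; exists x.
Qed.

End Vicsek.

(* Main.v *)
Require Import Defs.
From HB Require Import structures.
From Stdlib Require Import ZArith.
From mathcomp Require Import all_boot all_order all_algebra.
From mathcomp Require Import all_classical all_reals all_analysis.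
From mathcomp Require Import ring lra ssrZ zify.

(** Write S_j for the three inverse branches of the map R, and L_s for the
    transfer operator, which sends f to the function
    x |-> sum_j |S_j'(x)|^s f(S_j(x)).
    The Julia set J is the attractor of branches with disjoint images that
    contract with bounded distortion. By the principle of Bowen and Ruelle its
    dimension is the exponent s at which L_s has a positive eigenfunction of
    eigenvalue 1. The proof encloses this exponent with a test function f that
    is nearly an eigenfunction.

    If L_s f >= theta f on J, where f > 0 and theta > 1, then the sums of
    |S_w'|^s over the words w of length n grow like theta^n. The derivative of
    S_w bounds its difference quotients from below up to a constant that is
    independent of w ([word_distortion]). For large n the maps S_w thus have
    ratios p_w with sum_w p_w^s >= 1, and J has dimension at least s by the
    argument of Moran for self-similar sets ([moran_lower]): a cover of J cannot
    have a smaller total weight than the first cylinders, or else some path of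
    ever smaller cylinders would lead to a point that is not covered. If
    L_s f <= theta f with theta < 1, the images of J under the words of length n
    are covers whose weights tend to 0, and J has dimension at most s
    ([moran_upper]). These are [transfer_dim_ge] and [transfer_dim_le]. All the
    branches contract by at least 4, and so L_s is multiplied by at least
    1 + 3 d / 4 when s decreases by d, and divided by as much when s increases
    by d. A single exponent s with |L_s f - f| <= eta f therefore encloses the
    dimension up to a small multiple of eta ([transfer_dim_enclosure]). Here eta
    is 2^-51, and the distance of s to the two decimal bounds is more than
    3 10^-15.

    The test function is given by three polynomials of degree 15 on three
    intervals that contain J. They come from a numerical computation, but
    nothing is assumed about their origin: the inequality is verified
    ([test_function_defect]) with Taylor models, that is, with polynomials with
    an error bound, in integer arithmetic. Two operations are not polynomial. A
    branch is a root of R(z) = x; since R has slopes of at least 4 in absolute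
    value near the images of the branches, an approximate root is as good as its
    residual. The powers y^(-s) are split as y0^(-s) (1 + v)^(-s) with y0 a
    product of powers of 16/15, 25/24 and 81/80, so that only powers of numbers
    near 1 remain. A truncated binomial series approximates such a power,
    because it nearly solves the differential equation of the power
    ([binom_approx]). *)

Set Implicit Arguments.
Unset Strict Implicit.
Unset Printing Implicit Defensive.
Import Order.TTheory GRing.Theory Num.Theory.
Import numFieldNormedType.Exports.
Local Open Scope classical_set_scope.
Local Open Scope ring_scope.
Delimit Scope Z_scope with BZ.

(** * Hausdorff dimension of self-similar sets *)

Lemma geometric_small {R : realType} (a b e : R) : 0 <= a < 1 -> 0 < e ->
  exists N, forall n, (N <= n)%N -> a ^+ n * b <= e.
Proof.
move=> /andP[a0 a1] e0.
have /cvgrPdist_le /(_ e e0) [N _ NP] :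
    (fun n => a ^+ n * b) @ \oo --> (0 : R).
  rewrite -[X in _ --> X](mul0r b); apply: cvgMl.
  by apply: cvg_expr; rewrite ger0_norm.
exists N => n Nn; have := NP n Nn; rewrite /= sub0r normrN.
exact/le_trans/ler_norm.
Qed.

Section MoranUpper.
Context {R : realType} {I : eqType}.
Context (r : seq I) (T : I -> R -> R) (J : set R).
Context (q : I -> R) (rho D t : R).
Context (cover_J : J `<=` \bigcup_(i in [set` r]) (T i @` J)).
Context (stable_J : forall i x, i \in r -> J x -> J (T i x)).
Hypothesis lipschitz_T : forall i x y, i \in r -> J x -> J y ->
  `|T i x - T i y| <= q i * `|x - y|.
Context (q_rho : forall i, i \in r -> 0 <= q i <= rho).
Context (rho_lt1 : 0 <= rho < 1).
Context (bounded_J : forall x y, J x -> J y -> `|x - y| <= D).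
Context (D_ge0 : 0 <= D).
Context (t_gt0 : 0 < t).
Context (sum_q : \sum_(i <- r) q i `^ t < 1).

Let cell n : seq (set R * R) :=
  iter n (fun s => [seq (T i @` c.1, q i * c.2) | i <- r, c <- s]) [:: (J, D)].

Let cellP n c : c \in cell n ->
  [/\ c.1 `<=` J, 0 <= c.2 <= rho ^+ n * D &
      forall x y, c.1 x -> c.1 y -> `|x - y| <= c.2].
Proof.
have /andP[rho0 _] := rho_lt1.
elim: n c => [|n IH] c /=.
  by rewrite inE => /eqP -> /=; rewrite mul1r D_ge0 lexx; split.
move=> /allpairsP[[i d] /= [ir /IH[dJ /andP[d0 d1] dd] ->]] /=.
have /andP[q0 q1] := q_rho ir; split.
- by move=> _ [x /dJ Jx <-]; exact: stable_J.
- by rewrite mulr_ge0//= exprS -mulrA ler_pM.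
- move=> _ _ [x dx <-] [y dy <-].
  rewrite (le_trans (lipschitz_T ir (dJ _ dx) (dJ _ dy)))//.
  by rewrite ler_wpM2l// dd.
Qed.

Let cell_cover n x : J x -> exists2 c, c \in cell n & c.1 x.
Proof.
elim: n x => [|n IH] x Jx; first by exists (J, D); rewrite ?inE.
have [i ir [y Jy <-]] := cover_J Jx.
have [c cn cy] := IH _ Jy.
exists (T i @` c.1, q i * c.2); last by exists y.
by apply/allpairsP; exists (i, c).
Qed.

Let cell_sum n : \sum_(c <- cell n) c.2 `^ t <=
  (\sum_(i <- r) q i `^ t) ^+ n * D `^ t.
Proof.
elim: n => [|n IH] /=; first by rewrite big_seq1 mul1r.
rewrite big_allpairs_dep /= exprS -mulrA big_distrl /=.
rewrite big_seq [leRHS]big_seq; apply: ler_sum => i ir.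
apply: le_trans (_ : q i `^ t * \sum_(c <- cell n) c.2 `^ t <= _); last first.
  by rewrite ler_wpM2l// powR_ge0.
rewrite big_distrr /= big_seq [leRHS]big_seq; apply: ler_sum => c cn.
have /andP[q0 _] := q_rho ir; have [_ /andP[c0 _] _] := cellP cn.
by rewrite powRM.
Qed.

(** Iterated images of J are covers whose total weight decays geometrically. *)
Lemma moran_upper : hausdorff_measure t J = 0%E.
Proof.
have /andP[rho0 rho1] := rho_lt1.
have S0 : 0 <= \sum_(i <- r) q i `^ t by apply: sumr_ge0 => i _; exact: powR_ge0.
have weight_ge0 s (U : set R) : (0 <= hausdorff_weight s U)%E.
  by rewrite /hausdorff_weight; case: ifP => // _; exact: poweR_ge0.
have premeasure_ge0 d : (0 <= hausdorff_premeasure t d J)%E.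
  apply: le_ereal_inf_tmp => _ [U _ <-]; apply: nneseries_ge0 => n _ _.
  exact: weight_ge0.
suff pre0 d : 0 < d -> hausdorff_premeasure t d J = 0%E.
  rewrite /hausdorff_measure (_ : [set _ | _ in _] = [set 0%E]) ?ereal_sup1//.
  apply/seteqP; split=> [_ [d /pre0 d0 <-] //|_ ->].
  by exists 1; [exact: ltr01|exact: pre0].
move=> d0; apply/eqP; rewrite eq_le premeasure_ge0 andbT.
apply/lee_addgt0Pr => e e0; rewrite add0e.
have [N1 N1P] := geometric_small D rho_lt1 d0.
have [|N2 N2P] := @geometric_small R (\sum_(i <- r) q i `^ t) (D `^ t) e _ e0.
  by rewrite S0.
pose n := maxn N1 N2.
have {}N1P := N1P n (leq_maxl _ _); have {}N2P := N2P n (leq_maxr _ _).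
pose U k := nth set0 (map fst (cell n)) k.
pose c k := nth (set0, 0) (cell n) k.
have UE k : (k < size (cell n))%N -> U k = (c k).1.
  by move=> kn; rewrite /U (nth_map (set0, 0)).
have U0 k : (size (cell n) <= k)%N -> U k = set0.
  by move=> kn; rewrite /U nth_default// size_map.
have diamU k : (k < size (cell n))%N -> (diam (U k) <= ((c k).2)%:E)%E.
  move=> kn; rewrite UE//; have [_ _ cd] := cellP (mem_nth (set0, 0) kn).
  by apply: ge_ereal_sup => _ [p [p1 p2] <-]; rewrite lee_fin; exact: cd.
apply: (@le_trans _ _ (\sum_(0 <= k <oo) hausdorff_weight t (U k))%E).
  apply: ereal_inf_lbound; exists U => //; split.
    move=> x /(cell_cover n)[b bn bx]; exists (index b (cell n)) => //.
    by rewrite UE ?index_mem// /c nth_index.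
  move=> k; have [kn|kn] := ltnP k (size (cell n)).
    apply: le_trans (diamU _ kn) _; rewrite lee_fin.
    have [_ /andP[_ cd] _] := cellP (mem_nth (set0, 0) kn).
    exact: le_trans cd _.
  by rewrite U0//; apply: ge_ereal_sup => _ [p [[]]].
rewrite (@nneseries_split _ _ 0%N (size (cell n)))//.
rewrite [X in (_ + X)%E]eseries0 ?adde0 ?add0n; last first.
  by move=> k kn _; rewrite U0// /hausdorff_weight eqxx.
apply: (@le_trans _ _ (\sum_(0 <= k < size (cell n)) ((c k).2 `^ t)%:E)%E).
  rewrite !big_mkord; apply: lee_sum => -[k kn] _ /=.
  rewrite /hausdorff_weight; case: ifPn => [_|/set0P[x Ux]].
    by rewrite lee_fin powR_ge0.
  have dU0 : (0 <= diam (U k))%E.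
    by apply: ereal_sup_ubound; exists (x, x); rewrite //= subrr normr0.
  rewrite -poweR_EFin; apply: gt0_ler_poweR (diamU _ kn); first exact: ltW.
  - by rewrite in_itv/= dU0 leey.
  - by rewrite in_itv/= leey (le_trans dU0)// diamU.
rewrite sumEFin lee_fin (le_trans _ N2P)// (le_trans _ (cell_sum n))//.
by rewrite -(big_nth _ predT (fun c => c.2 `^ t)).
Qed.

End MoranUpper.

Section MoranLower.
Context {R : realType} {I : eqType}.
Context (r : seq I) (T : I -> R -> R) (J : set R).
Context (p : I -> R) (rho g t : R).
Context (uniq_r : uniq r) (nonempty_J : J !=set0) (compact_J : compact J).
Context (cover_J : J `<=` \bigcup_(i in [set` r]) (T i @` J)).
Context (stable_J : forall i x, i \in r -> J x -> J (T i x)).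
Context (expansion_T : forall i x y, i \in r -> J x -> J y ->
  p i * `|x - y| <= `|T i x - T i y|).
Context (gap_T : forall i j x y, i \in r -> j \in r -> i != j ->
  J x -> J y -> g <= `|T i x - T j y|).
Context (p_rho : forall i, i \in r -> 0 < p i <= rho) (rho_lt1 : rho < 1).
Context (g_gt0 : 0 < g) (t_gt0 : 0 < t).
Context (sum_p : 1 <= \sum_(i <- r) p i `^ t).

Let word_map (w : seq I) x := foldr T x w.
Let ratio (w : seq I) := \prod_(i <- w) p i.
Let legal (w : seq I) := all (mem r) w.

Let word_mapS w x : legal w -> J x -> J (word_map w x).
Proof.
by elim: w => //= i w IH /andP[ir wr] Jx; apply: stable_J => //; exact: IH.
Qed.

Let word_map_rcons w i x : word_map (rcons w i) x = word_map w (T i x).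
Proof. by rewrite /word_map foldr_rcons. Qed.

Let ratio_rcons w i : ratio (rcons w i) = ratio w * p i.
Proof. by rewrite /ratio -cats1 big_cat big_seq1. Qed.

Let ratio_gt0 w : legal w -> 0 < ratio w.
Proof.
rewrite /ratio; elim: w => [|i w IH] /=; first by rewrite big_nil.
by move=> /andP[/p_rho/andP[pi _] /IH]; rewrite big_cons; exact: mulr_gt0.
Qed.

Let ratio_expansion w x y : legal w -> J x -> J y ->
  ratio w * `|x - y| <= `|word_map w x - word_map w y|.
Proof.
rewrite /ratio; elim: w => [|i w IH] /=; first by rewrite big_nil mul1r.
move=> /andP[ir wr] Jx Jy; rewrite big_cons -mulrA.
apply: le_trans (expansion_T ir (word_mapS wr Jx) (word_mapS wr Jy)).
by have /andP[pi _] := p_rho ir; rewrite ler_pM2l//; exact: IH.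
Qed.

Let word_map_gap w i j x y : legal w -> i \in r -> j \in r -> i != j ->
  J x -> J y -> ratio w * g <= `|word_map w (T i x) - word_map w (T j y)|.
Proof.
move=> wr ir jr ij Jx Jy.
apply: le_trans (ratio_expansion wr (stable_J ir Jx) (stable_J jr Jy)).
by rewrite ler_wpM2l ?gap_T// ltW// ratio_gt0.
Qed.

Section Cover.
Context (U : nat -> set R) (a omega : nat -> R).
Context (cover_U : J `<=` \bigcup_k U k).
Context (diam_U : forall k x y, U k x -> U k y -> `|x - y| <= a k).
Context (omega_gt0 : forall k, 0 < omega k).
Context (omega_ge : forall k, a k `^ t <= omega k).

(* U k is charged to the cylinders of the words w such that inside w k. *)
Let inside w k := (exists2 y, J y & U k y) /\
  forall y, J y -> U k y -> exists2 z, J z & word_map w z = y.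

Let term w k : \bar R := if `[< inside w k >] then (omega k)%:E else 0%E.

Let mass w : \bar R := (\sum_(0 <= k <oo) term w k)%E.

Let bad w := legal w /\ (mass w < ((g * ratio w) `^ t)%:E)%E.

Let term_ge0 w k : (0 <= term w k)%E.
Proof. by rewrite /term; case: ifP => // _; rewrite lee_fin ltW. Qed.

Let inside_rcons w i k : i \in r -> inside (rcons w i) k -> inside w k.
Proof.
move=> ir [ne sub]; split => // y Jy Uy; have [z Jz <-] := sub _ Jy Uy.
by exists (T i z); [exact: stable_J|rewrite word_map_rcons].
Qed.

Let inside_inj w i j k : legal w -> i \in r -> j \in r ->
  inside (rcons w i) k -> inside (rcons w j) k -> i = j.
Proof.
move=> wr ir jr [[y Jy Uy] subi] [_ subj]; apply/eqP/negP => /negP ij.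
have [x Jx xE] := subi _ Jy Uy; have [z Jz zE] := subj _ Jy Uy.
have := word_map_gap wr ir jr ij Jx Jz.
rewrite -!word_map_rcons xE zE subrr normr0 leNgt.
by rewrite mulr_gt0// ratio_gt0.
Qed.

Let term_children w k : legal w ->
  (\sum_(i <- r) term (rcons w i) k <= term w k)%E.
Proof.
move=> wr; have [[i [ir ini]]|none] :=
    pselect (exists i, i \in r /\ inside (rcons w i) k).
  rewrite (bigD1_seq i)//= [X in (_ + X)%E]big_seq_cond big1 ?adde0; last first.
    move=> j /andP[jr ji]; rewrite /term asboolF// => inj.
    by move: ji; rewrite (inside_inj wr jr ir inj ini) eqxx.
  by rewrite /term !asboolT//; exact: inside_rcons ini.
rewrite big_seq big1// => i ir; rewrite /term asboolF// => ini.
by apply: none; exists i.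
Qed.

Let bad_child w : bad w -> exists i, i \in r /\ bad (rcons w i).
Proof.
move=> [wr wbad]; apply: contrapT => none.
have good i : i \in r -> (((g * ratio (rcons w i)) `^ t)%:E <= mass (rcons w i))%E.
  move=> ir; rewrite leNgt; apply/negP => h; apply: none; exists i; split=> //.
  by split=> //; rewrite /legal all_rcons; apply/andP.
move: wbad; rewrite ltNge => /negP; apply.
have rw0 := ratio_gt0 wr.
apply: (@le_trans _ _ (\sum_(i <- r) mass (rcons w i))%E); last first.
  rewrite /mass -nneseries_sum//; apply: lee_nneseries => k _.
    by move=> _; exact: sume_ge0.
  exact: term_children.
apply: (@le_trans _ _ (\sum_(i <- r) ((g * ratio (rcons w i)) `^ t)%:E)%E).
  rewrite sumEFin lee_fin.
  have gr0 : 0 <= g * ratio w by rewrite ltW// mulr_gt0.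
  apply: (@le_trans _ _ (\sum_(i <- r) (g * ratio w) `^ t * p i `^ t)).
    by rewrite -big_distrr /= ler_peMr// powR_ge0.
  rewrite big_seq [leRHS]big_seq; apply: ler_sum => i ir.
  have /andP[pi _] := p_rho ir.
  by rewrite ratio_rcons mulrA [leRHS]powRM ?(ltW pi)//.
by rewrite big_seq [leRHS]big_seq; apply: lee_sum => i; exact: good.
Qed.

Let mass_ge w k : inside w k -> ((omega k)%:E <= mass w)%E.
Proof.
move=> ink; have <- : term w k = (omega k)%:E by rewrite /term asboolT.
apply: le_trans (nneseries_lim_ge k.+1 _) => //.
by rewrite big_nat_recr//= leeDr// sume_ge0.
Qed.

(** Each set of the cover is charged to all the cylinders that contain its
    points of J. A set with points in two children of a cylinder is, because of
    the gap, as wide as the cylinder demands. Hence a cylinder that is charged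
    too little has a child that is charged too little, and so on along a path
    of cylinders, which accumulates at a point of J. The set that covers this
    point is charged to the whole path, where the demands tend to 0, although
    its weight is positive. *)
Lemma moran_mass : ((g `^ t)%:E <= \sum_(0 <= k <oo) (omega k)%:E)%E.
Proof.
rewrite leNgt; apply/negP => small.
have bad0 : bad [::].
  split => //; rewrite /ratio big_nil mulr1; apply: le_lt_trans small.
  apply: lee_nneseries => k _ //.
  by rewrite /term; case: ifP; rewrite ?lee_fin// ltW.
have step w : {i | bad w -> i \in r /\ bad (rcons w i)}.
  apply: cid; have [/bad_child[i ?]|nbad] := pselect (bad w); first by exists i.
  have [i ir] : exists i, i \in r.
    have [x /cover_J[i ir _]] := nonempty_J; by exists i.
  by exists i.
pose next w := projT1 (step w).
pose path n := iter n (fun w => rcons w (next w)) [::].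
have path_bad n : bad (path n).
  by elim: n => //= n IH; have [] := projT2 (step (path n)) IH.
have next_r n : next (path n) \in r.
  by have [] := projT2 (step (path n)) (path_bad n).
have path_legal n : legal (path n) by have [] := path_bad n.
have [x0 Jx0] := nonempty_J.
pose x n := word_map (path n) x0.
have Jx n : J (x n) by exact: word_mapS.
(* The path only accumulates: each cylinder contains all later points. *)
have tail n m : exists2 z, J z & x (n + m)%N = word_map (path n) z.
  suff H : forall z, J z -> exists2 z', J z' &
      word_map (path (n + m)%N) z = word_map (path n) z' by exact: H.
  elim: m => [|m IH] z Jz; first by exists z; rewrite ?addn0.
  rewrite addnS /path iterS -/(path (n + m)%N) word_map_rcons.
  by apply: IH; exact: stable_J.
have xJ : (x @ \oo) J by exists 0%N => // n _; exact: Jx.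
have [y [Jy cl_y]] := compact_J _ xJ.
have [k _ Uy] := cover_U Jy.
have in_path n : inside (path n) k.
  elim: n => [|n IH].
    by split; [exists y|move=> z Jz _; exists z].
  have [ne sub] := IH; split => // z Jz Uz.
  have [v Jv vz] := sub _ Jz Uz; have [j jr [v' Jv' v'E]] := cover_J Jv.
  have [ij|ij] := eqVneq (next (path n)) j.
    by exists v' => //=; rewrite word_map_rcons ij v'E.
  exfalso; have [_] := path_bad n; rewrite ltNge => /negP; apply.
  apply: le_trans (mass_ge IH); rewrite lee_fin.
  apply: le_trans (omega_ge k).
  have gr0 : 0 <= g * ratio (path n) by rewrite ltW// mulr_gt0// ratio_gt0.
  suff zy : g * ratio (path n) <= `|z - y|.
    have zya := le_trans zy (diam_U Uz Uy).
    by apply: ge0_ler_powR; rewrite ?nnegrE ?(le_trans gr0 zya) ?(ltW t_gt0).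
  rewrite leNgt; apply/negP => zy.
  pose e := g * ratio (path n) - `|z - y|.
  have e0 : 0 < e by rewrite subr_gt0.
  have tail_n : (x @ \oo) [set u | g * ratio (path n) <= `|u - z|].
    exists n.+1 => // m /= nm; have [u Ju] := tail n.+1 (m - n.+1)%N.
    rewrite subnKC// => ->; rewrite /= word_map_rcons -vz -v'E mulrC.
    by apply: word_map_gap.
  have [u [/= h1 h2]] := cl_y _ _ tail_n (nbhsx_ballx y e e0).
  move: h2; rewrite -ball_normE /= => h2.
  have : `|u - z| <= `|z - y| + `|y - u|.
    by rewrite distrC (le_trans _ (ler_normD _ _))// subrKA.
  by move: h1 h2; rewrite /e; lra.
have [i ir] : exists i, i \in r by exists (next (path 0)).
have rho_gt0 : 0 < rho by have /andP[p0] := p_rho ir; exact: lt_le_trans.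
have ratio_le n : ratio (path n) `^ t <= (rho `^ t) ^+ n.
  elim: n => [|n IH]; first by rewrite /ratio big_nil powR1.
  have /andP[p0 p1] := p_rho (next_r n).
  have rn0 := ratio_gt0 (path_legal n).
  rewrite [path _]iterS -/(path n) ratio_rcons powRM ?(ltW p0) ?(ltW rn0)//.
  rewrite exprSr ler_pM ?powR_ge0// ge0_ler_powR ?nnegrE// ltW//.
have lim0 : (fun n => (g `^ t) * (rho `^ t) ^+ n) @ \oo --> (0 : R).
  rewrite -[X in _ --> X](mulr0 (g `^ t)); apply: cvgMr; apply: cvg_expr.
  rewrite ger0_norm ?powR_ge0//; have <- : 1 `^ t = 1 :> R by rewrite powR1.
  by rewrite gt0_ltr_powR ?nnegrE// ltW.
move/cvgrPdist_lt : lim0 => /(_ _ (omega_gt0 k))[n _ /(_ n (leqnn n))] /=.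
rewrite sub0r normrN ger0_norm ?mulr_ge0 ?exprn_ge0 ?powR_ge0//.
apply/negP; rewrite -leNgt; have [_ bn] := path_bad n.
have := le_lt_trans (mass_ge (in_path n)) bn; rewrite lte_fin => /ltW.
rewrite powRM ?(ltW g_gt0) ?(ltW (ratio_gt0 _))// => /le_trans; apply.
by rewrite ler_wpM2l ?powR_ge0.
Qed.

End Cover.
(** The strict inequality s < t costs nothing on sets of diameter at most 1. The
    weights are enlarged by e / 2^(k+1) in order that even the one-point sets of
    a cover, which have diameter 0, get a positive weight. *)
Lemma moran_lower s : 0 <= s < t -> hausdorff_measure s J <> 0%E.
Proof.
move=> /andP[s0 st] measure0.
have gt0 : 0 < g `^ t by exact: powR_gt0.
suff : ((g `^ t)%:E <= hausdorff_premeasure s 1 J)%E.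
  apply/negP; rewrite -ltNge (@le_lt_trans _ _ 0%E) ?lte_fin//.
  rewrite -measure0; apply: ereal_sup_ubound.
  by exists 1 => //; exact: ltr01.
apply: le_ereal_inf_tmp => _ [U [JU U1] <-].
pose a k := if U k == set0 then 0 else fine (diam (U k)).
have diamE k : U k != set0 -> (0 <= diam (U k))%E /\ diam (U k) = (a k)%:E.
  move=> Uk; have /set0P[x Ux] := Uk; rewrite /a (negbTE Uk).
  have d0 : (0 <= diam (U k))%E.
    by apply: ereal_sup_ubound; exists (x, x); rewrite //= subrr normr0.
  split => //; rewrite fineK// ge0_fin_numE//.
  exact: le_lt_trans (U1 k) (ltry _).
have a_ge0 k : 0 <= a k.
  have [U0|/diamE[d0 dE]] := eqVneq (U k) set0; first by rewrite /a U0 eqxx.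
  by rewrite -lee_fin -dE.
have a_diam k x y : U k x -> U k y -> `|x - y| <= a k.
  move=> Ux Uy; have Uk : U k != set0 by apply/set0P; exists x.
  have [_ dE] := diamE _ Uk; rewrite -lee_fin -dE.
  by apply: ereal_sup_ubound; exists (x, y).
have weight_ge k : ((a k `^ t)%:E <= hausdorff_weight s (U k))%E.
  rewrite /hausdorff_weight; case: ifPn => [/eqP U0|Uk].
    by rewrite /a U0 eqxx powR0// gt_eqF.
  have [d0 dE] := diamE _ Uk; rewrite dE poweR_EFin lee_fin.
  have [->|a0] := eqVneq (a k) 0; first by rewrite powR0 ?powR_ge0// gt_eqF.
  apply: ger_powR; last exact: ltW.
  by rewrite lt_neqAle eq_sym a0 a_ge0 -lee_fin -dE U1.
apply: (@le_trans _ _ (\sum_(0 <= k <oo) (a k `^ t)%:E)%E); last first.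
  by apply: lee_nneseries => k _ //; rewrite lee_fin powR_ge0.
apply/lee_addgt0Pr => e e0.
pose omega k := a k `^ t + e / (2 ^ k.+1)%:R.
have e2 k : 0 < e / (2 ^ k.+1)%:R by rewrite divr_gt0// ltr0n expn_gt0.
apply: le_trans (epsilon_trick predT _ (ltW e0)); last first.
  by move=> k; rewrite lee_fin powR_ge0.
apply: (moran_mass (omega := omega) JU a_diam) => k.
  by rewrite ltr_wpDl ?powR_ge0.
by rewrite lerDl ltW.
Qed.

End MoranLower.

Section HausdorffDimension.
Context {R : realType}.
Implicit Types (s t : R) (J : set R).

Lemma hausdorff_dim_le t J : 0 <= t -> hausdorff_measure t J = 0%E ->
  (hausdorff_dim J <= t%:E)%E.
Proof. by move=> t0 Jt; apply: ereal_inf_lbound; exists t. Qed.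

Lemma hausdorff_dim_ge t J :
  (forall s, 0 <= s < t -> hausdorff_measure s J <> 0%E) ->
  (t%:E <= hausdorff_dim J)%E.
Proof.
move=> Jt; apply: le_ereal_inf_tmp => _ [s [s0 Js] <-]; rewrite lee_fin leNgt.
by apply/negP => st; apply: (Jt s) => //; rewrite s0.
Qed.

End HausdorffDimension.

(** * Taylor models over the integers *)

Fixpoint padd (p q : seq Z) : seq Z :=
  match p, q with
  | [::], _ => q
  | _, [::] => p
  | a :: p', b :: q' => (a + b)%BZ :: padd p' q'
  end.

Fixpoint pmul (p q : seq Z) : seq Z :=
  if p is a :: p' then padd (map (Z.mul a) q) (Z0 :: pmul p' q) else [::].

Definition pnorm (p : seq Z) : Z := foldr (fun a s => (Z.abs a + s)%BZ) Z0 p.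

(** Coefficients and error are multiples of 1/scale; the polynomial is in a
    variable u that ranges over [-1, 1]. *)
Record tmodel := TModel { coefs : seq Z; error : Z }.

Section Operations.
Context (scale : Z) (degree : nat).

Definition tcst (a : Z) : tmodel := TModel [:: a] 0.
Definition tint (k : Z) : tmodel := tcst (k * scale).
Definition trat (a b : Z) : tmodel := TModel [:: (a * scale / b)%BZ] 1.
Definition tadd (s t : tmodel) : tmodel :=
  TModel (padd (coefs s) (coefs t)) (error s + error t).
Definition topp (t : tmodel) : tmodel :=
  TModel (map Z.opp (coefs t)) (error t).
Definition tbound (t : tmodel) : Z := (pnorm (coefs t) + error t)%BZ.
(** Rounding costs one unit for each coefficient, and the powers of u beyond the
    degree are absorbed by the error, because |u| <= 1. *)
Definition tmul (s t : tmodel) : tmodel :=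
  let c := map (fun a => a / scale)%BZ (pmul (coefs s) (coefs t)) in
  TModel (take degree c)
    (pnorm (drop degree c) + Z.of_nat (size c) + 1 +
     (pnorm (coefs s) * error t + error s * tbound t) / scale).
Definition texp (t : tmodel) (n : nat) : tmodel := iter n (tmul t) (tint 1).
Definition thorner (p : seq Z) (t : tmodel) : tmodel :=
  foldr (fun c r => tadd (tmul r t) (tcst c)) (TModel [::] 0) p.

(** The coefficients of (1 + v)^(-sigma/scale), from that of v^k, which is b. *)
Fixpoint binom_coefs (sigma : Z) (n : nat) (k b : Z) : seq Z :=
  b :: (if n is n'.+1 then
          binom_coefs sigma n' (k + 1)%BZ
            (- ((k * scale + sigma) * b) / ((k + 1) * scale))%BZ
        else [::]).

(** For a polynomial p whose coefficients stand for those of v^k, v^(k+1) and so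
    on of a series, this bounds, on |v| <= d, the coefficients from v^k on of
    (1 + v) f' + s f, where f is the series: the equation f' = - s f / (1 + v)
    characterizes (1 + v)^(-s), up to a factor. *)
Fixpoint binom_error (sigma d k : Z) (p : seq Z) : Z :=
  if p is b :: q then
    ((Z.abs ((k + 1) * head Z0 q * scale + (k * scale + sigma) * b) +
      d * binom_error sigma d (k + 1) q) / scale + 1)%BZ
  else Z0.

Definition tpow (sigma : Z) (n : nat) (t : tmodel) : tmodel :=
  let p := binom_coefs sigma n 0 scale in
  let r := thorner p t in
  TModel (coefs r) (error r + binom_error sigma (tbound t) 0 p).

End Operations.

HB.lock Definition zr (R : realFieldType) (a : Z) : R := (int_of_Z a)%:~R.

Section TaylorModel.
Context {R : realFieldType}.
Local Notation zr := (@zr R).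
Implicit Types (u g h : R) (p q : seq Z) (s t : tmodel).

Lemma zr0 : zr 0 = 0. Proof. by rewrite unlock. Qed.
Lemma zr1 : zr 1 = 1. Proof. by rewrite unlock. Qed.
Lemma zrD a b : zr (a + b)%BZ = zr a + zr b.
Proof. by rewrite unlock -intrD -(raddfD int_of_Z). Qed.
Lemma zrN a : zr (- a)%BZ = - zr a.
Proof. by rewrite unlock -mulrNz -(raddfN int_of_Z). Qed.
Lemma zrM a b : zr (a * b)%BZ = zr a * zr b.
Proof. by rewrite unlock -intrM -(rmorphM int_of_Z). Qed.
Lemma zr_le a b : (zr a <= zr b) = (a <=? b)%BZ.
Proof. by rewrite unlock ler_int; lia. Qed.
Lemma zr_lt a b : (zr a < zr b) = (a <? b)%BZ.
Proof. by rewrite ltNge zr_le; lia. Qed.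
Lemma zr_abs a : zr (Z.abs a) = `|zr a|.
Proof. by rewrite unlock -intr_norm; congr (_%:~R); lia. Qed.
Lemma zr_nat n : zr (Z.of_nat n) = n%:R.
Proof. by rewrite unlock pmulrn; congr (_%:~R); lia. Qed.

Lemma zrX a n : zr (a ^ Z.of_nat n)%BZ = zr a ^+ n.
Proof.
elim: n => [|n IH]; first by rewrite zr1.
by rewrite Nat2Z.inj_succ Z.pow_succ_r ?zrM ?IH ?exprS//; lia.
Qed.

Definition zrE := (zrD, zrN, zrM, zr_abs, zr_nat, zr0, zr1).

Lemma zr_div_ge a b : 0 < zr b -> zr a / zr b - 1 <= zr (a / b)%BZ.
Proof.
rewrite -zr0 zr_lt => b0; rewrite lerBlDr ler_pdivrMr -?zr1 -?zrE -?zr0 ?zr_lt// zr_le.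
by have := Z.mod_pos_bound a b; have := Z.div_mod a b; nia.
Qed.

Lemma zr_div_le a b : 0 < zr b -> zr (a / b)%BZ <= zr a / zr b.
Proof.
rewrite -zr0 zr_lt => b0; rewrite ler_pdivlMr -?zrE -?zr0 ?zr_lt// zr_le.
by have := Z.mod_pos_bound a b; have := Z.div_mod a b; nia.
Qed.

Definition peval p u : R := foldr (fun a v => zr a + u * v) 0 p.

Lemma peval_add p q u : peval (padd p q) u = peval p u + peval q u.
Proof.
elim: p q => [|a p IH] [|b q] /=; rewrite ?add0r ?addr0//.
by rewrite IH zrE; ring.
Qed.

Lemma peval_scale a p u : peval (map (Z.mul a) p) u = zr a * peval p u.
Proof. by elim: p => [|b p IH] /=; rewrite ?mulr0// IH zrE; ring. Qed.

Lemma peval_opp p u : peval (map Z.opp p) u = - peval p u.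
Proof. by elim: p => [|b p IH] /=; rewrite ?oppr0// IH zrE; ring. Qed.

Lemma peval_mul p q u : peval (pmul p q) u = peval p u * peval q u.
Proof.
elim: p => [|a p IH] /=; first by rewrite mul0r.
by rewrite peval_add peval_scale /= IH zr0; ring.
Qed.

Lemma peval_cat p q u : peval (p ++ q) u = peval p u + u ^+ size p * peval q u.
Proof.
elim: p => [|a p IH] /=; first by rewrite add0r mul1r.
by rewrite IH exprS; ring.
Qed.

Lemma peval_norm p u : `|u| <= 1 -> `|peval p u| <= zr (pnorm p).
Proof.
move=> u1; elim: p => [|a p IH] /=; first by rewrite normr0 zr0.
rewrite !zrE (le_trans (ler_normD _ _))// lerD2l normrM.
by rewrite (le_trans _ IH)// ler_piMl.
Qed.

Context (scale : Z) (degree : nat).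
Context (scale_gt0 : (0 <? scale)%BZ).

Let M0 : 0 < zr scale. Proof. by rewrite -zr0 zr_lt. Qed.

Lemma peval_div p u : `|u| <= 1 ->
  `|peval p u / zr scale - peval (map (fun a => a / scale)%BZ p) u|
    <= (size p)%:R.
Proof.
move=> u1; elim: p => [|a p IH] /=; first by rewrite mul0r subr0 normr0.
rewrite -natr1 [leRHS]addrC; set b := zr (a / scale)%BZ.
have -> : (zr a + u * peval p u) / zr scale - (b + u *
    peval (map (fun a => a / scale)%BZ p) u) = (zr a / zr scale - b) +
    u * (peval p u / zr scale - peval (map (fun a => a / scale)%BZ p) u) by ring.
rewrite (le_trans (ler_normD _ _))// lerD//; last first.
  by rewrite normrM (le_trans _ IH)// ler_piMl.
have := zr_div_ge a M0; have := zr_div_le a M0; rewrite -/b ler_norml; lra.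
Qed.

Definition encl u t g : Prop := `|zr scale * g - peval (coefs t) u| <= zr (error t).

Lemma encl_cst u a : encl u (tcst a) (zr a / zr scale).
Proof. by rewrite /encl /= zr0 mulr0 addr0 mulrC divfK ?gt_eqF// subrr normr0. Qed.

Lemma encl_int u k : encl u (tint scale k) (zr k).
Proof. by have := encl_cst u (k * scale); rewrite zrE mulfK ?gt_eqF. Qed.

Lemma encl_rat u a b : (0 <? b)%BZ -> encl u (trat scale a b) (zr a / zr b).
Proof.
rewrite -zr_lt zr0 => b0; have := zr_div_ge (a * scale) b0.
have := zr_div_le (a * scale) b0; rewrite /encl /= mulr0 addr0 zr1 zrM.
by rewrite mulrCA mulrA ler_norml; lra.
Qed.

Lemma encl_add u s t g h : encl u s g -> encl u t h -> encl u (tadd s t) (g + h).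
Proof.
rewrite /encl /= peval_add zrE => sg th.
by rewrite mulrDr opprD addrACA (le_trans (ler_normD _ _))// lerD.
Qed.

Lemma encl_opp u t g : encl u t g -> encl u (topp t) (- g).
Proof. by rewrite /encl /= peval_opp mulrN -opprD normrN. Qed.

Lemma encl_bound u t g : `|u| <= 1 -> encl u t g ->
  `|zr scale * g| <= zr (tbound t).
Proof.
move=> u1 tg; rewrite zrE -[zr scale * g](subrK (peval (coefs t) u)) addrC.
by rewrite (le_trans (ler_normD _ _))// lerD// peval_norm.
Qed.

Lemma encl_mul u s t g h : `|u| <= 1 -> encl u s g -> encl u t h ->
  encl u (tmul scale degree s t) (g * h).
Proof.
move=> u1 sg th; rewrite /encl /=.
set p := pmul _ _; set c := map _ p.
set P := peval (coefs s) u; set Q := peval (coefs t) u.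
set E := (pnorm (coefs s) * _ + _)%BZ.
have cE : peval c u = peval (take degree c) u +
    u ^+ size (take degree c) * peval (drop degree c) u.
  by rewrite -peval_cat cat_take_drop.
have -> : zr scale * (g * h) - peval (take degree c) u =
    ((zr scale * g) * (zr scale * h) - P * Q) / zr scale +
    (peval p u / zr scale - peval c u) +
    u ^+ size (take degree c) * peval (drop degree c) u.
  have split_error (m X Y k l : R) : m != 0 -> m * (g * h) - k =
      (m * g * (m * h) - X * Y) / m + (X * Y / m - (k + l)) + l by move=> ?; field.
  by rewrite cE peval_mul; apply: split_error; exact: lt0r_neq0.
have e1 : `|u ^+ size (take degree c) * peval (drop degree c) u| <=
    zr (pnorm (drop degree c)).
  have := peval_norm (drop degree c) u1; rewrite normrM normrX.
  by apply: le_trans; rewrite ler_piMl// exprn_ile1.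
have e2 : `|peval p u / zr scale - peval c u| <= zr (Z.of_nat (size c)).
  by rewrite zr_nat size_map; exact: peval_div.
have e3 : `|((zr scale * g) * (zr scale * h) - P * Q) / zr scale| <=
    zr (E / scale)%BZ + 1.
  rewrite -lerBlDr; apply: le_trans (zr_div_ge E M0); rewrite lerB//.
  rewrite normrM normfV (gtr0_norm M0) ler_pM2r ?invr_gt0//.
  have -> : zr scale * g * (zr scale * h) - P * Q =
    P * (zr scale * h - Q) + (zr scale * g - P) * (zr scale * h) by ring.
  rewrite (le_trans (ler_normD _ _))// !normrM zrD !zrM.
  apply: lerD; apply: ler_pM => //; first exact: peval_norm.
  by rewrite -normrM; exact: encl_bound u1 th.
rewrite (le_trans (ler_normD _ _))//.
rewrite (le_trans (lerD (ler_normD _ _) (lexx _)))//.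
by move: e1 e2 e3; rewrite !zrD zr1; lra.
Qed.

Lemma encl_exp u t g n : `|u| <= 1 -> encl u t g ->
  encl u (texp scale degree t n) (g ^+ n).
Proof.
move=> u1 tg; elim: n => [|n IH]; first by rewrite expr0 -zr1; exact: encl_int.
by rewrite exprS; exact: encl_mul.
Qed.

Lemma encl_horner u p t g : `|u| <= 1 -> encl u t g ->
  encl u (thorner scale degree p t) (peval p g / zr scale).
Proof.
move=> u1 tg; elim: p => [|a p IH] /=.
  by rewrite /encl /= mul0r mulr0 subrr normr0 zr0.
have -> : (zr a + g * peval p g) / zr scale =
  (peval p g / zr scale) * g + zr a / zr scale by ring.
by apply: encl_add; [exact: encl_mul|exact: encl_cst].
Qed.

End TaylorModel.

(** * Powers of models near 1 *)

Section PowerModel.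
Context {R : realType}.
Local Notation zr := (@zr R).
Implicit Types (u v w : R) (p : seq Z).

Fixpoint dpeval p u : R := if p is a :: q then peval q u + u * dpeval q u else 0.

Lemma is_derive_peval p u : is_derive u 1 (peval p : R -> R) (dpeval p u).
Proof.
elim: p => [|a p IH] /=; first exact: is_derive_cst.
have -> : peval (a :: p) = cst (zr a) + id * peval p by exact: funext.
apply: is_derive_eq (is_deriveD (is_derive_cst (zr a) u (1 : R))
  (is_deriveM (is_derive_id u (1 : R)) IH)) _.
by rewrite /GRing.scale /=; ring.
Qed.

Context (scale sigma : Z) (degree : nat).
Context (scale_gt0 : (0 <? scale)%BZ).
Context (sigma_gt0 : (0 <? sigma)%BZ).
Context (sigma_lt : (sigma <? scale)%BZ).

Local Notation s := (zr sigma / zr scale).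

Let M0 : 0 < zr scale. Proof. by rewrite -zr0 zr_lt. Qed.

Let s01 : 0 < s < 1.
Proof.
by rewrite divr_gt0 ?ltr_pdivrMr ?mul1r -?zr0 ?zr_lt// scale_gt0.
Qed.

(* With f = v^k p, this is ((1 + v) f' + s f) / v^k without the term k p(0) / v:
   the part of the residual of f that comes from the powers v^k and above. *)
Let residual (k : Z) p v : R :=
  (1 + v) * dpeval p v + (zr k + s) * peval p v + zr k * peval (behead p) v.

Let residual_cons k a p v : residual k (a :: p) v =
  (zr (k + 1)%BZ * zr (head Z0 p) + (zr k + s) * zr a) + v * residual (k + 1)%BZ p v.
Proof.
rewrite /residual zrD zr1 /=; case: p => [|b p] /=; first by rewrite zr0; ring.
ring.
Qed.

Let residual_le k p d v : `|zr scale * v| <= zr d ->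
  `|residual k p v| <= zr (binom_error scale sigma d k p).
Proof.
move=> vd; elim: p k => [|a p IH] k.
  by rewrite /residual /= !mulr0 !addr0 normr0 zr0.
rewrite residual_cons; set e := binom_error scale sigma d (k + 1) p.
have -> : binom_error scale sigma d k (a :: p) =
  ((Z.abs ((k + 1) * head Z0 p * scale + (k * scale + sigma) * a) + d * e)
    / scale + 1)%BZ by [].
rewrite [leRHS]zrD zr1 -lerBlDr.
apply: le_trans (zr_div_ge _ M0); rewrite lerB// ler_pdivlMr//.
rewrite [leRHS]zrD zr_abs [zr (d * _)]zrM -[X in _ * X <= _]gtr0_norm// -normrM.
set A := ((k + 1) * head Z0 p * scale + (k * scale + sigma) * a)%BZ.
set B := _ + v * _.
have -> : B * zr scale = zr A + (zr scale * v) * residual (k + 1)%BZ p v.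
  rewrite /A /B !(zrD, zrM) zr1; move: (residual _ _ _) => r.
  move: (zr (head _ _)) (zr a) (zr k) (zr sigma) (lt0r_neq0 M0).
  by move: (zr scale) => m h a' k' g m0; field.
rewrite (le_trans (ler_normD _ _))// lerD2l normrM.
by apply: ler_pM => //; exact: IH.
Qed.

(** The derivative of (1 + v)^s p is (1 + v)^(s - 1) ((1 + v) p' + s p). If the
    second factor is small then (1 + v)^s p hardly varies, and it equals p(0) at
    v = 0. For |v| <= 1/8 the other factors multiply to less than 1. *)
Lemma binom_approx p d v : head Z0 p = scale -> `|v| <= 8^-1 ->
  `|zr scale * v| <= zr d ->
  `|peval p v - zr scale * (1 + v) `^ (- s)| <= zr (binom_error scale sigma d 0 p).
Proof.
move=> p0 v8 vd; have /andP[s0 s1] := s01.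
set E := zr (binom_error _ _ _ _ _).
pose l w := ln (1 + w).
(* The mean value theorem is applied along the segment from 0 to v. *)
pose g t : R := peval p (t * v) * expR (s * l (t * v)).
have tv8 (t : R) : 0 <= t <= 1 -> `|t * v| <= 8^-1.
  move=> /andP[t0 t1]; rewrite normrM ger0_norm//.
  by rewrite (le_trans _ v8)// ler_piMl.
have pos w : `|w| <= 8^-1 -> 7 / 8 <= 1 + w <= 9 / 8.
  by rewrite ler_norml => /andP[? ?]; apply/andP; split; lra.
pose dg t := expR (s * l (t * v)) * (v / (1 + t * v)) * residual 0 p (t * v).
have dE (t : R) : 0 <= t <= 1 -> is_derive t 1 g (dg t).
  move=> t01; have /andP[w0 _] := pos _ (tv8 _ t01).
  have dtv : is_derive t 1 (fun x : R => x * v) v.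
    rewrite (_ : (fun x : R => x * v) = id * cst v)//.
    apply: is_derive_eq (is_deriveM (is_derive_id t (1 : R))
      (is_derive_cst v t (1 : R))) _.
    by rewrite /GRing.scale /=; ring.
  have d1 : is_derive t 1 (fun x => peval p (x * v)) (dpeval p (t * v) * v).
    exact: (@is_derive1_comp _ (peval p) (fun x => x * v) _ _ _
      (is_derive_peval _ _) dtv).
  have d2 : is_derive t 1 (fun x => 1 + x * v) v.
    rewrite (_ : (fun x => 1 + x * v) = cst 1 + (fun x => x * v))//.
    by apply: is_derive_eq (is_deriveD (is_derive_cst (1 : R) t (1 : R)) dtv) _; rewrite add0r.
  have d3 : is_derive t 1 (fun x => l (x * v)) ((1 + t * v)^-1 * v).
    have p0' : 0 < 1 + t * v by lra.
    exact: (@is_derive1_comp _ (@ln R) (fun x => 1 + x * v) t _ _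
      (is_derive1_ln p0') d2).
  have d4 : is_derive t 1 (fun x => s * l (x * v)) (s * ((1 + t * v)^-1 * v)).
    rewrite (_ : (fun x => s * l (x * v)) = s \*: (fun x => l (x * v)))//.
    exact: is_deriveZ.
  have d5 : is_derive t 1 (fun x => expR (s * l (x * v)))
      (expR (s * l (t * v)) * (s * ((1 + t * v)^-1 * v))).
    exact: (@is_derive1_comp _ expR (fun x => s * l (x * v)) _ _ _
      (is_derive_expR _) d4).
  rewrite (_ : g = (fun x => peval p (x * v)) * (fun x => expR (s * l (x * v))))//.
  apply: is_derive_eq (is_deriveM d1 d5) _.
  rewrite /GRing.scale /= /dg /residual zr0.
  have leibniz (e P D Q c w : R) : 1 + w != 0 ->
    P * (e * (c * ((1 + w)^-1 * v))) + e * (D * v) =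
    e * (v / (1 + w)) * ((1 + w) * D + (0 + c) * P + 0 * Q) by move=> ?; field.
  by apply: leibniz; rewrite gt_eqF//; lra.
have [| |t t01] := @MVT_segment R g dg 0 1 ler01.
- move=> t; rewrite in_itv/= => /andP[t0 t1]; apply: dE.
  by rewrite (ltW t0) (ltW t1).
- apply: derivable_within_continuous => t; rewrite in_itv/= => t01.
  by have [] := dE _ t01.
rewrite subr0 mulr1 => gE.
have p0E : peval p 0 = zr scale.
  by case: (p) p0 => [|a q] /= <-; rewrite ?zr0// mul0r addr0.
have powE : (1 + v) `^ (- s) = expR (- (s * l v)).
  by rewrite /powR gt_eqF ?mulNr//; have := pos _ v8; lra.
have -> : peval p v - zr scale * (1 + v) `^ (- s) = expR (- (s * l v)) * dg t.
  rewrite powE -gE /g !mul1r mul0r /l addr0 ln1 mulr0 expR0 mulr1 p0E mulrBr.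
  by rewrite mulrCA -expRD addNr expR0 mulr1 [zr scale * _]mulrC.
move: t01; rewrite in_itv/= => t01; have tv := tv8 _ t01.
rewrite /dg !mulrA -expRD normrM -[leRHS]mul1r ler_pM//; last first.
  apply: residual_le; rewrite (le_trans _ vd)// !normrM mulrCA ler_piMl//.
  by rewrite ger0_norm; lra.
have /andP[a0 a1] := pos _ tv; have /andP[b0 b1] := pos _ v8.
have Epos : 0 < 9 / 7 :> R by lra.
have ln97 : 0 <= ln (9 / 7 : R) by apply: ln_ge0; lra.
have e97 : expR (- (s * l v) + s * l (t * v)) <= 9 / 7.
  rewrite -[leRHS](lnK Epos) ler_expR addrC -mulrBr -ln_div ?posrE; [|lra..].
  rewrite (le_trans _ (_ : s * ln (9 / 7) <= _)) ?ler_piMl//; last exact: ltW.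
  rewrite ler_pM2l// ler_ln ?posrE ?divr_gt0//; [|lra..].
  by rewrite ler_pdivrMr; lra.
rewrite !normrM normfV (@ger0_norm _ (expR _)) ?expR_ge0// -mulrA.
rewrite (@ger0_norm _ (1 + _)); last lra.
have q17 : `|v| / (1 + t * v) <= 1 / 7.
  by rewrite ler_pdivrMr; lra.
by apply: le_trans (ler_pM _ _ e97 q17) _; rewrite ?expR_ge0 ?divr_ge0//; lra.
Qed.

Lemma encl_pow n u t v : `|u| <= 1 -> encl scale u t v ->
  (8 * tbound t <=? scale)%BZ ->
  encl scale u (tpow scale degree sigma n t) ((1 + v) `^ (- s)).
Proof.
move=> u1 tv b8; rewrite /encl /= zrD.
set p := binom_coefs _ _ _ _ _; have vd := encl_bound u1 tv.
have v8 : `|v| <= 8^-1.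
  have z8 : zr 8 = 8 by rewrite unlock.
  move: vd b8; rewrite -(zr_le (R := R)) zrM z8 normrM (gtr0_norm M0) => vd b8.
  have : 8 * (zr scale * `|v|) <= zr scale by apply: le_trans b8; rewrite ler_pM2l.
  by rewrite mulrCA ger_pMr// => ?; lra.
have p0 : head Z0 p = scale by rewrite /p; case: (n).
have := binom_approx p0 v8 vd; rewrite distrC.
have := encl_horner degree scale_gt0 p u1 tv; rewrite /encl mulrC divfK ?gt_eqF//.
set h := peval (coefs _) _ => e1 e2.
rewrite (_ : _ - h = (peval p v - h) + (zr scale * (1 + v) `^ (- s) - peval p v));
  last by ring.
by rewrite (le_trans (ler_normD _ _))// lerD.
Qed.

End PowerModel.

(** * The inverse branches *)

Section Branches.
Context {R : realType}.
Implicit Types x y z a b c : R.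

Definition vicsek_der z : R := 108 * z ^+ 2 + 96 * z + 15.

(** The divided difference of the map. *)
Definition vicsek_slope a b : R :=
  36 * (a ^+ 2 + a * b + b ^+ 2) + 48 * (a + b) + 15.

Lemma vicsek_mapB a b :
  vicsek_map a - vicsek_map b = (a - b) * vicsek_slope a b.
Proof. by rewrite /vicsek_map /vicsek_slope; ring. Qed.

Lemma vicsek_slopexx a : vicsek_slope a a = vicsek_der a.
Proof. by rewrite /vicsek_slope /vicsek_der; ring. Qed.

(** The images of the branches are [-0.9083, -5/6], [-1/2, -1/3] and
    [-0.0918, 0]. There is some room around them, for approximations of the
    branches. *)
Definition in_piece (j : nat) z : bool :=
  match j with
  | 0%N => -1 <= z <= - (4 / 5)
  | 1%N => - (51 / 100) <= z <= - (8 / 25)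
  | _ => - (1 / 10) <= z <= 1 / 100
  end.

(** The first two formulas are sorted, so that each of them has its values in a
    single interval. *)
Definition branch (j : nat) x : R :=
  match j with
  | 0%N => Num.min (vicsek_branch1 x) (vicsek_branch2 x)
  | 1%N => Num.max (vicsek_branch1 x) (vicsek_branch2 x)
  | _ => vicsek_branch3 x
  end.

Let preimage_pieces z : -1 <= z <= 0 -> -1 <= vicsek_map z <= 0 ->
  [\/ in_piece 0 z, in_piece 1 z | in_piece 2 z].
Proof.
move=> /andP[z1 z0]; rewrite /vicsek_map => /andP[m1 m0] /=.
have [h1|h1] := leP z (- (4 / 5)); first by constructor 1; rewrite z1.
have [h2|h2] := ltP z (- (51 / 100)).
  have : 0 < (- (6 * z + 3)) * (6 * z + 5) by apply: mulr_gt0; lra.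
  by move=> ?; exfalso; nra.
have [h3|h3] := leP z (- (8 / 25)); first by constructor 2.
have [h4|h4] := ltP z (- (1 / 10)); last by constructor 3; apply/andP; split; lra.
(* The map takes the value -1 at the zeros of (3 z + 1) (12 z^2 + 12 z + 1). *)
exfalso; have q : 12 * z ^+ 2 + 12 * z + 1 < 0.
  have : 0 < (z + 8 / 25) * (- z - 1 / 10) by apply: mulr_gt0; lra.
  by nra.
have : 0 < (3 * z + 1) * (- (12 * z ^+ 2 + 12 * z + 1)) by apply: mulr_gt0; lra.
by nra.
Qed.

Lemma branchP j x : x \in `[-1, 0] ->
  [/\ in_piece j (branch j x), branch j x \in `[-1, 0] &
      vicsek_map (branch j x) = x].
Proof.
move=> x01; have := x01; rewrite in_itv /= => xb.
have [i1 i2 i3] := vicsek_branch_itv x01.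
have [k1 k2 k3] := vicsek_branchK x01.
(* The three branches are the roots of one cubic polynomial, and their sum allows
   only one of them in each interval. *)
have [sum b3] : vicsek_branch1 x + vicsek_branch2 x + vicsek_branch3 x = - (4 / 3)
    /\ - (2 / 9) <= vicsek_branch3 x.
  rewrite /vicsek_branch1 /vicsek_branch2 /vicsek_branch3.
  have [a [b [[_ _ a2] -> -> ->]]] := vicsek_branchE x01.
  by split=> /=; [field|lra].
move: i1 i2 i3; rewrite !in_itv /= => i1 i2 i3.
have p1 := preimage_pieces i1; have p2 := preimage_pieces i2.
have p3 := preimage_pieces i3.
move: p1 p2 p3; rewrite k1 k2 k3 => /(_ xb) p1 /(_ xb) p2 /(_ xb) p3.
have {p3} w3 : in_piece 2 (vicsek_branch3 x).
  by case: p3 => //=; lra.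
have w12 : in_piece 0 (Num.min (vicsek_branch1 x) (vicsek_branch2 x)) /\
           in_piece 1 (Num.max (vicsek_branch1 x) (vicsek_branch2 x)).
  move: sum p1 p2 w3 i1 i2; move: (vicsek_branch1 x) (vicsek_branch2 x) => c d.
  move=> sum p1 p2 w3 i1 i2.
  have [cd|dc] := leP c d; case: p1 p2 => /= p1 [] /= p2; move: w3 => /= w3;
    first [by split | by exfalso; lra].
case: j => [|[|j]] /=; split=> //.
- by case: w12.
- by case: (leP (vicsek_branch1 x)) => _; rewrite ?in_itv.
- by case: leP.
- by case: w12.
- by case: (leP (vicsek_branch1 x)) => _; rewrite ?in_itv.
- by case: leP.
Qed.

Lemma slope_bound j a b : in_piece j a -> in_piece j b ->
  4 <= `|vicsek_slope a b| <= 32.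
Proof.
rewrite /vicsek_slope; case: j => [|[|j]] /= /andP[a1 a2] /andP[b1 b2].
- have : 0 <= (- a - 4 / 5) * (- b - 4 / 5) by apply: mulr_ge0; lra.
  have : 0 <= (- a - 4 / 5) ^+ 2 by exact: sqr_ge0.
  have : 0 <= (- b - 4 / 5) ^+ 2 by exact: sqr_ge0.
  move=> h1 h2 h3; rewrite ger0_norm; last nra.
  by apply/andP; split; nra.
- have h1 : 0 <= (a + 51 / 100) * (- (8 / 25) - a) by apply: mulr_ge0; lra.
  have h2 : 0 <= (b + 51 / 100) * (- (8 / 25) - b) by apply: mulr_ge0; lra.
  have h3 : 0 <= (a + 51 / 100) * (- (8 / 25) - b) by apply: mulr_ge0; lra.
  have h4 : 0 <= (b + 51 / 100) * (- (8 / 25) - a) by apply: mulr_ge0; lra.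
  rewrite ltr0_norm; last nra.
  by apply/andP; split; nra.
- have h1 : 0 <= (a + 1 / 10) * (1 / 100 - a) by apply: mulr_ge0; lra.
  have h2 : 0 <= (b + 1 / 10) * (1 / 100 - b) by apply: mulr_ge0; lra.
  have h3 : 0 <= (a + 1 / 10) * (b + 1 / 10) by apply: mulr_ge0; lra.
  have h5 : 0 <= (1 / 100 - a) * (1 / 100 - b) by apply: mulr_ge0; lra.
  have h6 := sqr_ge0 a; have h7 := sqr_ge0 b.
  have h8 := sqr_ge0 (a + b); have h9 := sqr_ge0 (a - b).
  rewrite ger0_norm; last nra.
  by apply/andP; split; nra.
Qed.

Lemma piece_gap i j a b : (i < 3)%N -> (j < 3)%N -> i != j ->
  in_piece i a -> in_piece j b -> 5^-1 <= `|a - b|.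
Proof.
case: i => [|[|[|//]]]; case: j => [|[|[|//]]] //= _ _ _ /andP[a1 a2] /andP[b1 b2];
  by rewrite ler_normr; apply/orP; ((left; lra) || (right; lra)).
Qed.

Lemma piece_norm j a : in_piece j a -> `|a| <= 1.
Proof.
by rewrite ler_norml; case: j => [|[|j]] /= /andP[a1 a2]; apply/andP; split; lra.
Qed.

Lemma slope_der j a b c : in_piece j a -> in_piece j b -> in_piece j c ->
  `|vicsek_slope a b - vicsek_der c| <= 156 * (`|a - c| + `|b - c|).
Proof.
move=> /piece_norm na /piece_norm nb /piece_norm nc.
have -> : vicsek_slope a b - vicsek_der c =
    (a - c) * (36 * (a + c) + 36 * b + 48) + (b - c) * (36 * (b + c) + 36 * c + 48).
  by rewrite /vicsek_slope /vicsek_der; ring.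
rewrite (le_trans (ler_normD _ _))// !normrM [leRHS]mulrDr.
move: na nb nc; rewrite !ler_norml => /andP[? ?] /andP[? ?] /andP[? ?].
by apply: lerD; rewrite mulrC ler_wpM2r// ler_norml; apply/andP; split; lra.
Qed.

(** The relative deviation is at most 156/4 = 39 times the distances. *)
Lemma slope_distortion j a b c : in_piece j a -> in_piece j b -> in_piece j c ->
  let e := expR (39 * (`|a - c| + `|b - c|)) in
  `|vicsek_slope a b| <= `|vicsek_der c| * e /\
  `|vicsek_der c| <= `|vicsek_slope a b| * e.
Proof.
move=> ja jb jc /=; set d := `|a - c| + `|b - c|.
have /andP[s4 _] := slope_bound ja jb.
have /andP[d4 _] := slope_bound jc jc; rewrite vicsek_slopexx in d4.
have close := slope_der ja jb jc; rewrite -/d in close.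
have d0 : 0 <= d by rewrite addr_ge0.
have e1 : 1 + 39 * d <= expR (39 * d) by exact: expR_ge1Dx.
have b1 : `|vicsek_slope a b| <= `|vicsek_der c| + 156 * d.
  by rewrite -lerBlDl (le_trans (lerB_dist _ _)).
have b2 : `|vicsek_der c| <= `|vicsek_slope a b| + 156 * d.
  by rewrite -lerBlDl (le_trans (lerB_dist _ _))// distrC.
have absorb (k : R) : 4 <= k -> k + 156 * d <= k * expR (39 * d).
  move=> k4; apply: le_trans (_ : k * (1 + 39 * d) <= _); last first.
    by rewrite ler_wpM2l//; lra.
  by nra.
by split; [apply: le_trans b1 _|apply: le_trans b2 _]; exact: absorb.
Qed.

Lemma branch_dist j x y : x \in `[-1, 0] -> y \in `[-1, 0] ->
  `|branch j x - branch j y| =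
  `|x - y| / `|vicsek_slope (branch j x) (branch j y)|.
Proof.
move=> x01 y01; have [jx _ kx] := branchP j x01; have [jy _ ky] := branchP j y01.
have /andP[s4 _] := slope_bound jx jy.
have : `|vicsek_map (branch j x) - vicsek_map (branch j y)| = `|x - y|.
  by rewrite kx ky.
by rewrite vicsek_mapB normrM => <-; rewrite mulfK// gt_eqF//; lra.
Qed.

Lemma branch_contract j x y : x \in `[-1, 0] -> y \in `[-1, 0] ->
  `|branch j x - branch j y| <= `|x - y| / 4.
Proof.
move=> x01 y01; rewrite branch_dist//.
have [jx _ _] := branchP j x01; have [jy _ _] := branchP j y01.
have /andP[s4 _] := slope_bound jx jy.
by rewrite ler_wpM2l// lef_pV2 ?posrE//; lra.
Qed.

Lemma branch_expand j x y : x \in `[-1, 0] -> y \in `[-1, 0] ->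
  `|x - y| / 32 <= `|branch j x - branch j y|.
Proof.
move=> x01 y01; rewrite branch_dist//.
have [jx _ _] := branchP j x01; have [jy _ _] := branchP j y01.
have /andP[s4 s32] := slope_bound jx jy.
by rewrite ler_wpM2l// lef_pV2 ?posrE//; lra.
Qed.

End Branches.

(** * From the transfer operator to the dimension *)

Section Words.
Context {R : realType}.
Implicit Types (x y z : R) (w : seq nat).
Local Notation J := (@vicsek_julia R).

Definition digits : seq nat := [:: 0; 1; 2]%N.

Fixpoint words (n : nat) : seq (seq nat) :=
  if n is n'.+1 then [seq j :: w | j <- digits, w <- words n'] else [:: [::]].

Definition word_branch w x : R := foldr branch x w.

Definition rate (j : nat) x : R := `|vicsek_der (branch j x)|^-1.

(** The absolute value of the derivative of [word_branch w] at x. *)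
Fixpoint word_rate w x : R :=
  if w is j :: w' then word_rate w' x * rate j (word_branch w' x) else 1.

Lemma words_uniq n : uniq (words n).
Proof.
elim: n => [//|n IH]; apply: (allpairs_uniq (f := cons)) => //.
by move=> [i v] [j w] _ _ /= [-> ->].
Qed.

Lemma wordsP n w : w \in words n -> size w = n /\ all (mem digits) w.
Proof.
elim: n w => [|n IH] w; first by rewrite inE => /eqP ->.
by move=> /allpairsP[[j v] [/= jd /IH[<- vd] ->]] /=; rewrite vd andbT.
Qed.

Lemma word_branch_rcons w j x :
  word_branch (rcons w j) x = word_branch w (branch j x).
Proof. by rewrite /word_branch foldr_rcons. Qed.

Lemma word_rate_rcons w j x :
  word_rate (rcons w j) x = word_rate w (branch j x) * rate j x.
Proof.
elim: w => [|i w IH] /=; first by [].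
by rewrite IH word_branch_rcons mulrAC.
Qed.

Lemma rate_bound j x : x \in `[-1, 0] -> 0 < rate j x <= 4^-1.
Proof.
move=> x01; have [jx _ _] := branchP j x01.
have /andP[d4 _] := slope_bound jx jx; rewrite vicsek_slopexx in d4.
have d0 : 0 < `|vicsek_der (branch j x)| by lra.
by rewrite /rate invr_gt0 d0 lef_pV2 ?posrE.
Qed.

Lemma word_branch_itv w x : x \in `[-1, 0] -> word_branch w x \in `[-1, 0].
Proof. by move=> x01; elim: w => //= j w IH; have [_] := branchP j IH. Qed.

Lemma word_rate_bound w x : x \in `[-1, 0] ->
  0 < word_rate w x <= 4^-1 ^+ size w.
Proof.
move=> x01; elim: w => [|j w /andP[w0 w1]] /=; first by rewrite ltr01 expr0 lexx.
have /andP[r0 r1] := rate_bound j (word_branch_itv w x01).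
by rewrite mulr_gt0//= exprSr ler_pM// ltW.
Qed.

(** The slope of a chord and the derivative at a third point differ, one branch
    at a time, by a factor controlled by the distances of the points; under
    further branches these distances shrink geometrically. The constant 13
    satisfies (13 + 39) / 4 <= 13, which is the step of the induction. *)
Lemma word_distortion w x y z :
  x \in `[-1, 0] -> y \in `[-1, 0] -> z \in `[-1, 0] ->
  let e := expR (13 * (`|x - z| + `|y - z|)) in
  `|word_branch w x - word_branch w y| <= `|x - y| * word_rate w z * e /\
  `|x - y| * word_rate w z <= `|word_branch w x - word_branch w y| * e.
Proof.
elim/last_ind: w x y z => [|w j IH] x y z x01 y01 z01 /=.
  rewrite mulr1; set d := 13 * _.
  have e1 : 1 <= expR d by rewrite -expR0 ler_expR mulr_ge0// addr_ge0.
  by split; rewrite ler_peMr.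
have [jx ax _] := branchP j x01; have [jy ay _] := branchP j y01.
have [jz az _] := branchP j z01.
have [IH1 IH2] := IH _ _ _ ax ay az.
rewrite !word_branch_rcons word_rate_rcons.
have [s1 s2] := slope_distortion jx jy jz.
have cx := branch_contract j x01 z01; have cy := branch_contract j y01 z01.
have dist := branch_dist j x01 y01.
have /andP[slope4 _] := slope_bound jx jy.
have /andP[der4 _] := slope_bound jz jz; rewrite vicsek_slopexx in der4.
have /andP[wr0 _] := word_rate_bound w az.
move: IH1 IH2 s1 s2 cx cy dist slope4 der4 wr0; rewrite /rate.
move: (word_branch w _) (word_branch w _) (word_rate w _) => X Y W.
move: (branch j x) (branch j y) (branch j z) => a b c.
move: `|vicsek_slope a b| `|vicsek_der c| => S D.
set d := `|a - c| + `|b - c| => IH1 IH2 s1 s2 cx cy dist S4 D4 W0.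
have ee : expR (13 * d) * expR (39 * d) <= expR (13 * (`|x - z| + `|y - z|)).
  by rewrite -expRD ler_expR; move: cx cy; rewrite /d; lra.
have S0 : 0 < S by lra. have D0 : 0 < D by lra.
split.
- apply: le_trans IH1 _; rewrite dist.
  apply: le_trans (_ : `|x - y| * (W / D) * (expR (13 * d) * expR (39 * d)) <= _).
    rewrite [leRHS](_ : _ = `|x - y| / S * W * expR (13 * d) * (S * expR (39 * d) / D)).
      rewrite ler_peMr ?mulr_ge0 ?expR_ge0 ?invr_ge0 ?(ltW S0) ?(ltW D0) ?(ltW W0)//.
      by rewrite ler_pdivlMr// mul1r.
    by field; rewrite !gt_eqF.
  by rewrite ler_wpM2l ?mulr_ge0 ?invr_ge0 ?(ltW S0) ?(ltW D0) ?(ltW W0).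
- apply: le_trans (_ : `|Y - X| * (expR (13 * d) * expR (39 * d)) <= _); last first.
    by rewrite ler_wpM2l.
  rewrite [leRHS]mulrA; apply: le_trans (_ : `|a - b| * W * expR (39 * d) <= _); last first.
    by rewrite ler_wpM2r// expR_ge0.
  rewrite dist [leRHS](_ : _ = `|x - y| * (W / D) * (D * expR (39 * d) / S)).
    rewrite ler_peMr ?mulr_ge0 ?invr_ge0 ?(ltW S0) ?(ltW D0) ?(ltW W0)//.
    by rewrite ler_pdivlMr// mul1r.
  by field; rewrite !gt_eqF.
Qed.

Lemma julia_itv x : J x -> x \in `[-1, 0].
Proof. by have [_ _ sub _] := @vicsek_julia_invariant R; exact: sub. Qed.

Lemma julia0 : J 0.
Proof. exact: vicsek_invariant0 vicsek_julia_invariant. Qed.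

Lemma julia_compact : compact J.
Proof.
have [_ cl sub _] := @vicsek_julia_invariant R.
by apply: subclosed_compact cl (@segment_compact _ _ _) sub.
Qed.

Lemma julia_branch j x : J x -> J (branch j x).
Proof.
have [_ _ _ JE] := @vicsek_julia_invariant R; move=> Jx.
have J1 : J (vicsek_branch1 x) by rewrite JE; left; left; exists x.
have J2 : J (vicsek_branch2 x) by rewrite JE; left; right; exists x.
have J3 : J (vicsek_branch3 x) by rewrite JE; right; exists x.
by case: j => [|[|j]] //=; case: leP.
Qed.

Lemma julia_preimage y : J y -> exists j x, [/\ j \in digits, J x & y = branch j x].
Proof.
have [_ _ _ JE] := @vicsek_julia_invariant R; rewrite {1}JE => -[[|]|] [x Jx <-].
- have [le|le] := leP (vicsek_branch1 x) (vicsek_branch2 x).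
    by exists 0%N, x; split=> //=; rewrite (min_idPl le).
  by exists 1%N, x; split=> //=; rewrite (max_idPl (ltW le)).
- have [le|le] := leP (vicsek_branch1 x) (vicsek_branch2 x).
    by exists 1%N, x; split=> //=; rewrite (max_idPr le).
  by exists 0%N, x; split=> //=; rewrite (min_idPr (ltW le)).
- by exists 2%N, x.
Qed.

Lemma julia_word w x : J x -> J (word_branch w x).
Proof. by move=> Jx; elim: w => //= j w; exact: julia_branch. Qed.

Lemma julia_words n y : J y ->
  exists w x, [/\ w \in words n, J x & y = word_branch w x].
Proof.
elim: n y => [|n IH] y Jy; first by exists [::], y.
have [j [x [jd Jx ->]]] := julia_preimage Jy.
have [w [z [wn Jz ->]]] := IH _ Jx.
by exists (j :: w), z; split=> //; apply/allpairsP; exists (j, w).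
Qed.

Lemma words_gap n v w x y : v \in words n -> w \in words n -> v != w ->
  J x -> J y -> 5^-1 / 32 ^+ n <= `|word_branch v x - word_branch w y|.
Proof.
move=> vn wn vw /julia_itv x01 /julia_itv y01.
elim: n v w vn wn vw => [|n IH] v w; first by rewrite !inE => /eqP -> /eqP ->.
move=> /allpairsP[[i v'] [idg vn ->]] /allpairsP[[j w'] [jdg wn ->]].
rewrite /= in idg vn jdg wn *; move=> vw.
have v01 := word_branch_itv v' x01; have w01 := word_branch_itv w' y01.
have p0 : 0 < 32 ^+ n :> R by rewrite exprn_gt0.
have p1 : 1 <= 32 ^+ n :> R by rewrite exprn_ege1//; lra.
have [ij|ij] := eqVneq i j.
  move: vw; rewrite -ij eqseq_cons eqxx /= => /(IH _ _ vn wn) gap.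
  apply: le_trans (branch_expand i v01 w01).
  by rewrite exprSr invfM mulrA ler_pM2r// invr_gt0.
have digit_lt k : k \in digits -> (k < 3)%N by rewrite !inE => /or3P[] /eqP ->.
have [pi _ _] := branchP i v01; have [pj _ _] := branchP j w01.
apply: le_trans (piece_gap (digit_lt _ idg) (digit_lt _ jdg) ij pi pj).
by rewrite ler_piMr// invf_le1 ?exprn_gt0// exprn_ege1//; lra.
Qed.

End Words.

Section Transfer.
Context {R : realType}.
Implicit Types (x y : R) (f : R -> R).
Local Notation J := (@vicsek_julia R).

Definition transfer (t : R) f x : R :=
  \sum_(j <- digits) rate j x `^ t * f (branch j x).

Let word_sum t f n x : R :=
  \sum_(w <- words n) word_rate w x `^ t * f (word_branch w x).

Let word_sumS t f n x : J x -> word_sum t f n.+1 x =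
  \sum_(w <- words n) word_rate w x `^ t * transfer t f (word_branch w x).
Proof.
move=> /julia_itv x01.
rewrite /word_sum -/(words n.+1) (big_allpairs_dep (h := cons)).
rewrite exchange_big; apply: eq_bigr => w _.
rewrite /transfer big_distrr; apply: eq_bigr => j _ /=.
have /andP[w0 _] := word_rate_bound w x01.
have /andP[r0 _] := rate_bound j (word_branch_itv w x01).
by rewrite powRM ?(ltW w0) ?(ltW r0)// mulrA.
Qed.

Context (f : R -> R) (m M t theta : R) (t_gt0 : 0 < t) (m_gt0 : 0 < m).
Context (f_bound : forall x, J x -> m <= f x <= M) (theta_ge0 : 0 <= theta).

Let f0 x : J x -> 0 <= f x.
Proof. by move=> /f_bound/andP[+ _]; apply: le_trans; exact: ltW. Qed.

Let M_gt0 : 0 < M.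
Proof.
by have /andP[h1 h2] := f_bound julia0; exact: lt_le_trans (le_trans h1 h2).
Qed.

Let word_sum_ge n x : (forall x, J x -> theta * f x <= transfer t f x) ->
  J x -> theta ^+ n * f x <= word_sum t f n x.
Proof.
move=> fE Jx; elim: n => [|n IH].
  by rewrite /word_sum big_seq1 /= powR1.
rewrite word_sumS// exprS -mulrA (le_trans (ler_wpM2l theta_ge0 IH))//.
rewrite /word_sum big_distrr; apply: ler_sum => w _ /=.
by rewrite mulrCA ler_wpM2l ?powR_ge0// fE//; exact: julia_word.
Qed.

Let word_sum_le n x : (forall x, J x -> transfer t f x <= theta * f x) ->
  J x -> word_sum t f n x <= theta ^+ n * f x.
Proof.
move=> fE Jx; elim: n => [|n IH].
  by rewrite /word_sum big_seq1 /= powR1.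
rewrite word_sumS// exprS -mulrA (le_trans _ (ler_wpM2l theta_ge0 IH))//.
rewrite /word_sum big_distrr; apply: ler_sum => w _ /=.
by rewrite mulrCA ler_wpM2l ?powR_ge0// fE//; exact: julia_word.
Qed.

Let zero01 : (0 : R) \in `[-1, 0]. Proof. exact: julia_itv julia0. Qed.

Let distortion x y w : J x -> J y ->
  `|word_branch w x - word_branch w y| <= word_rate w 0 * expR 26 * `|x - y| /\
  word_rate w 0 / expR 26 * `|x - y| <= `|word_branch w x - word_branch w y|.
Proof.
move=> /julia_itv x01 /julia_itv y01.
have [d1 d2] := word_distortion w x01 y01 zero01.
have le26 : 13 * (`|x - 0| + `|y - 0|) <= 26.
  move: x01 y01; rewrite !in_itv /= !subr0 => /andP[? ?] /andP[? ?].
  by rewrite !ler0_norm//; lra.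
rewrite -ler_expR in le26; have /andP[w0 _] := word_rate_bound w zero01.
split.
- apply: le_trans d1 _; rewrite [leRHS]mulrC [leRHS]mulrA.
  by rewrite ler_wpM2l// mulr_ge0// ltW.
- rewrite mulrAC ler_pdivrMr ?expR_gt0// [leLHS]mulrC (le_trans d2)//.
  by rewrite ler_wpM2l.
Qed.

(** Iteration of the inequality makes the sum of the derivatives to the power t,
    over the words of length n, grow like theta^n. For large n the growth
    outweighs both the distortion and the oscillation of f, and the branches of
    the words of length n satisfy the hypotheses of [moran_lower]. *)
Lemma transfer_dim_ge : 1 < theta ->
  (forall x, J x -> theta * f x <= transfer t f x) ->
  (t%:E <= hausdorff_dim J)%E.
Proof.
move=> theta1 fE; apply: hausdorff_dim_ge => s st.
have e26 : 1 < expR 26 :> R by rewrite -expR0 ltr_expR.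
have [n nP] : exists n, M * expR 26 `^ t <= theta ^+ n * m.
  have th0 : 0 < theta by exact: lt_trans theta1.
  have [|N NP] := @geometric_small R theta^-1 (M * expR 26 `^ t) m _ m_gt0.
    by rewrite invr_ge0 theta_ge0 invf_lt1.
  exists N; have := NP N (leqnn N).
  by rewrite exprVn mulrC ler_pdivrMr ?exprn_gt0// [leRHS]mulrC.
apply: (@moran_lower _ _ (words n) word_branch J
  (fun w => word_rate w 0 / expR 26) (expR 26)^-1 (5^-1 / 32 ^+ n) t) => //.
- exact: words_uniq.
- by exists 0; exact: julia0.
- exact: julia_compact.
- by move=> y /(julia_words n)[w [x [wn Jx ->]]]; exists w => //; exists x.
- by move=> w x _; exact: julia_word.
- by move=> w x y _ Jx Jy; have [] := distortion w Jx Jy.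
- by move=> v w x y vn wn vw Jx Jy; exact: words_gap.
- move=> w _; have /andP[w0 w1] := word_rate_bound w zero01.
  rewrite divr_gt0 ?expR_gt0// ler_piMl ?invr_ge0 ?expR_ge0//.
  by rewrite (le_trans w1)// exprn_ile1//; lra.
- by rewrite invf_lt1// expR_gt0.
have sum_ge : theta ^+ n * m <= M * \sum_(w <- words n) word_rate w 0 `^ t.
  apply: le_trans (_ : theta ^+ n * f 0 <= _).
    by rewrite ler_wpM2l ?exprn_ge0//; have /andP[] := f_bound julia0.
  apply: le_trans (word_sum_ge n fE julia0) _.
  rewrite /word_sum big_distrr; apply: ler_sum => w _ /=.
  rewrite mulrC ler_wpM2r ?powR_ge0//.
  by have /andP[] := f_bound (julia_word w julia0).
have E0 : 0 < expR 26 `^ t :> R by rewrite powR_gt0// expR_gt0.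
rewrite (eq_bigr (fun w => word_rate w 0 `^ t * (expR 26 `^ t)^-1)); last first.
  move=> w _; have /andP[w0 _] := word_rate_bound w zero01.
  rewrite powRM ?invr_ge0 ?expR_ge0 ?ltW//; congr (_ * _).
  by rewrite -powR_inv1 ?expR_ge0// -!powRrM mulN1r powRN.
rewrite -big_distrl /= ler_pdivlMr// mul1r -(ler_pM2l M_gt0).
exact: le_trans nP sum_ge.
Qed.

(** The same with [moran_upper]; n is also large enough for these branches to
    be contractions despite the distortion. *)
Lemma transfer_dim_le : theta < 1 ->
  (forall x, J x -> transfer t f x <= theta * f x) ->
  (hausdorff_dim J <= t%:E)%E.
Proof.
move=> theta1 fE; apply: hausdorff_dim_le; first exact: ltW.
have E0 : 0 < expR 26 `^ t :> R by rewrite powR_gt0// expR_gt0.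
have [n n1 n2] : exists2 n, 4^-1 ^+ n * expR 26 <= 2^-1 :> R &
    theta ^+ n * (M / m * expR 26 `^ t) < 1.
  have q01 : 0 <= (4^-1 : R) < 1 by apply/andP; split; lra.
  have h0 : 0 < 2^-1 :> R by lra.
  have [N1 P1] := geometric_small (expR 26) q01 h0.
  have [|N2 P2] := @geometric_small R theta (M / m * expR 26 `^ t) 2^-1 _ h0.
    by rewrite theta_ge0.
  exists (maxn N1 N2); first exact: P1 (leq_maxl _ _).
  by have := P2 _ (leq_maxr N1 N2); lra.
apply: (@moran_upper _ _ (words n) word_branch J
  (fun w => word_rate w 0 * expR 26) 2^-1 1 t) => //.
- by move=> y /(julia_words n)[w [x [wn Jx ->]]]; exists w => //; exists x.
- by move=> w x _; exact: julia_word.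
- by move=> w x y _ Jx Jy; have [] := distortion w Jx Jy.
- move=> w /wordsP[wn _]; have /andP[w0 w1] := word_rate_bound w zero01.
  rewrite mulr_ge0 ?expR_ge0 ?(ltW w0)//= (le_trans _ n1)//.
  by rewrite ler_wpM2r ?expR_ge0// -wn.
- by apply/andP; split; lra.
- move=> x y /julia_itv + /julia_itv; rewrite !in_itv /= => /andP[? ?] /andP[? ?].
  by rewrite ler_norml; apply/andP; split; lra.
rewrite (eq_bigr (fun w => word_rate w 0 `^ t * expR 26 `^ t)); last first.
  move=> w _; have /andP[w0 _] := word_rate_bound w zero01.
  by rewrite powRM ?expR_ge0 ?ltW.
rewrite -big_distrl /=; apply: le_lt_trans n2.
rewrite mulrA ler_pM2r// mulrA ler_pdivlMr//.
rewrite big_distrl /=; apply: le_trans (_ : word_sum t f n 0 <= _).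
  apply: ler_sum => w _; rewrite ler_wpM2l ?powR_ge0//.
  by have /andP[] := f_bound (julia_word w julia0).
apply: le_trans (word_sum_le n fE julia0) _.
by rewrite ler_wpM2l ?exprn_ge0//; have /andP[] := f_bound julia0.
Qed.

End Transfer.

Section ExponentPerturbation.
Context {R : realType}.
Local Notation J := (@vicsek_julia R).

Let powR_quarter (rho d : R) : 0 < rho <= 4^-1 -> 0 <= d ->
  1 + 3 / 4 * d <= rho `^ (- d).
Proof.
move=> /andP[r0 r4] d0; have lnr : ln rho <= - (3 / 4).
  have -> : rho = 1 + (rho - 1) by ring.
  by apply: le_trans (le_ln1Dx _) _; lra.
rewrite /powR gt_eqF//; apply: le_trans (expR_ge1Dx _).
by rewrite lerD2l mulNr -mulrN mulrC ler_wpM2l//; lra.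
Qed.

(** Every branch contracts by a factor rho <= 1/4, and rho^(-d) >= 1 - d ln rho
    >= 1 + 3 d / 4. Hence moving the exponent by d scales the transfer operator
    by at least 1 + 3 d / 4, which outweighs the defect eta. *)
Lemma transfer_dim_enclosure (f : R -> R) (m M s eta lo hi : R) :
  0 < m -> (forall x, J x -> m <= f x <= M) ->
  0 <= eta -> 0 < lo ->
  2 * eta < 3 / 4 * (s - lo) -> s - lo <= 1 -> eta < 3 / 4 * (hi - s) ->
  (forall x, J x -> `|transfer s f x - f x| <= eta * f x) ->
  (lo%:E <= hausdorff_dim J)%E /\ (hausdorff_dim J <= hi%:E)%E.
Proof.
move=> m0 fb eta0 lo0 lo_s lo1 s_hi fE.
have rate_pos x j : J x -> 0 < rate j x <= 4^-1.
  by move=> /julia_itv; exact: rate_bound.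
have f0 x j : J x -> 0 <= f (branch j x).
  move=> /(julia_branch j)/fb/andP[+ _]; apply: le_trans; exact: ltW.
have split_rate x j (t d : R) : J x -> rate j x `^ (t - d) = rate j x `^ t * rate j x `^ (- d).
  by move=> /(rate_pos _ j)/andP[r0 _]; apply: powRD; rewrite (gt_eqF r0) /= implybT.
split.
- apply: (@transfer_dim_ge _ f m M lo ((1 + 3 / 4 * (s - lo)) * (1 - eta))) => //.
  + by apply: mulr_ge0; lra.
  + by nra.
  move=> x Jx; have := fE x Jx; rewrite ler_norml => /andP[fx _].
  apply: le_trans (_ : (1 + 3 / 4 * (s - lo)) * transfer s f x <= _).
    by rewrite -[leLHS]mulrA ler_wpM2l//; lra.
  rewrite /transfer big_distrr; apply: ler_sum => j _ /=.
  have -> : rate j x `^ lo = rate j x `^ s * rate j x `^ (- (s - lo)).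
    by rewrite -split_rate// subKr.
  rewrite [leLHS]mulrA ler_wpM2r ?f0// [leLHS]mulrC ler_wpM2l ?powR_ge0//.
  by apply: powR_quarter; [exact: rate_pos|lra].
- have d0 : 0 <= hi - s by lra.
  apply: (@transfer_dim_le _ f m M hi ((1 + eta) / (1 + 3 / 4 * (hi - s)))) => //.
  + by lra.
  + by apply: divr_ge0; lra.
  + by rewrite ltr_pdivrMr; lra.
  move=> x Jx; have := fE x Jx; rewrite ler_norml => /andP[_ fx].
  apply: le_trans (_ : transfer s f x / (1 + 3 / 4 * (hi - s)) <= _); last first.
    by rewrite [leRHS]mulrAC ler_pM2r ?invr_gt0; lra.
  rewrite /transfer big_distrl; apply: ler_sum => j _ /=.
  have /andP[r0 r4] := rate_pos x j Jx.
  rewrite [leRHS]mulrAC ler_wpM2r ?f0//.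
  have -> : rate j x `^ hi = rate j x `^ s * rate j x `^ (hi - s).
    by rewrite -[hi - s]opprK -split_rate// opprK addrC subrK.
  rewrite ler_wpM2l ?powR_ge0// -[X in _ `^ X]opprK powRN.
  rewrite lef_pV2 ?posrE ?powR_gt0//; last by lra.
  by apply: powR_quarter; rewrite ?r0.
Qed.

End ExponentPerturbation.

(** * The test function and the certificate *)

Definition scale : Z := 18446744073709551616%BZ.

Definition degree : nat := 16.

Definition order : nat := 15.

(** The exponent sigma/scale at which the transfer operator is evaluated is the
    dimension, 0.49195457005266634441 and so on, to the precision of the scale. *)
Definition sigma : Z := 9074960049653353347%BZ.

(** The polynomials interpolate an approximate eigenfunction of the transfer
    operator at Chebyshev points of the three intervals. *)
Definition eigen_coef : seq (seq Z) :=
  [::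
    [:: 19298453789151546019; (-192676823231153889); 13227545663422998;
    (-690014171434157); 44478988048654; (-2867624842996); 192959611839;
    (-13186791947); 915962537; (-64321563); 4558495; (-325424); 23369;
    (-1687); 125; (-9)];
    [:: 18226639889839812533; (-37043542993464629); 23963650720972960;
    (-324834999037033); 103032239141672; (-2535976030412); 546417488363;
    (-19067571108); 3199227294; (-141206578); 19901130; (-1038785); 129049;
    (-7619); 888; (-58)];
    [:: 18541670472866521157; 104777167595643348; 9737599582474425;
    321852834002291; 20733997793148; 999400146762; 59248423132; 3246367809;
    190466875; 10974496; 648387; 38251; 2281; 136; 8; 1]]%BZ.

(** Likewise the j-th polynomial of the i-th group interpolates the branch j on
    the interval i. *)
Definition branch_coef : seq (seq (seq Z)) :=
  [::
   [::
    [:: (-16610196555602076351); 43574107260184272; 314388243374711;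
    3993771599245; 62245918773; 1079967874; 20021340; 388286; 7780; 160; 3];
    [:: (-6599966998940169931); (-127223388355151371); 1487088433985250;
    (-74214506630936); 3321502217628; (-183136420780); 10461729779;
    (-632210171); 39361821; (-2515680); 163917; (-10852); 728; (-49); 3];
    [:: (-1385495210403822540); 83649281094967099; (-1801476677359961);
    70220735031691; (-3383748136401); 182056452906; (-10481751118); 631821884;
    (-39369601); 2515520; (-163920); 10852; (-728); 49; (-3)]];
   [::
    [:: (-16037603177039945062); 117632937063901202; 2614064889632495;
    103105075808736; 5001638535672; 270373805580; 15625286919; 944930552;
    59052925; 3783512; 247187; 16405; 1103; 75; 5];
    [:: (-7990693026287395961); (-245147356612861956); 627362335538915;
    (-249845421666251); 3176382985914; (-778458723555); 18128256782;
    (-3291634384); 109561999; (-16204758); 685906; (-87612); 4400; (-505); 30;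
    (-3)];
    [:: (-567362561618727799); 127514419548960754; (-3241427225171410);
    146740345857514; (-8178021521585); 508084917975; (-33753543700);
    2346703832; (-168614924); 12421246; (-933093); 71206; (-5503); 430; (-35);
    3]];
   [::
    [:: (-15455376435469697219); 81563743867021251; 1476062355280630;
    47894606248295; 1916679827965; 85568397255; 4086230502; 204254473;
    10552852; 559027; 30200; 1657; 92; 5];
    [:: (-9083274759456234897); (-139143744335570238); (-893438147588933);
    (-58311681198509); (-1687911187070); (-91163744038); (-3939963265);
    (-208254897); (-10439797); (-562302); (-30103); (-1660); (-92); (-5)];
    [:: (-57007570020136705); 57580000468548986; (-582624207691696);
    10417074950214; (-228768640895); 5595346783; (-146267237); 4000424;
    (-113055); 3275; (-97); 3]]]%BZ.

(** In row i and column j, a rational number n/d near the absolute values of the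
    derivative of the map at the branch j of the interval i, with exponents such
    that n/d = (16/15)^a (25/24)^b (81/80)^c. Every positive rational number with
    no other prime factors than 2, 3 and 5 is such a product, with integral
    exponents, so that three powers give the powers of all these numbers. *)
Definition base_data : seq (seq (Z * Z * (nat * nat * nat))) :=
  [:: [:: (16, 1, (28, 20, 12)%N); (45, 8, (17, 13, 8)%N); (25, 3, (21, 16, 9)%N)];
      [:: (40, 3, (26, 19, 11)%N); (25, 4, (18, 14, 8)%N); (12, 1, (25, 18, 11)%N)];
      [:: (32, 3, (24, 17, 10)%N); (6, 1, (18, 13, 8)%N); (400, 27, (27, 20, 11)%N)]]%BZ.

(** The intervals have these centers and radii divided by 1024, and contain
    the images of the branches. *)
Definition center (j : nat) : Z :=
  (match j with 0%N => -892 | 1%N => -427 | _ => -47 end)%BZ.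

Definition radius (j : nat) : Z :=
  (match j with 0%N => 39 | 1%N => 86 | _ => 47 end)%BZ.

Definition eigen j := nth [::] eigen_coef j.

Local Notation tconst := (tint scale).
Local Notation tfrac := (trat scale).
Local Notation tprod := (tmul scale degree).
Local Notation tpower := (texp scale degree).
Local Notation tpoly := (thorner scale degree).
Local Notation troot := (tpow scale degree sigma order).

Definition tpoint i : tmodel :=
  tadd (tfrac (center i) 1024) (tprod (tfrac (radius i) 1024) (TModel [:: Z0; scale] 0)).

Definition tvicsek z : tmodel :=
  tprod (tprod z (tadd (tprod (tconst 6) z) (tconst 3))) (tadd (tprod (tconst 6) z) (tconst 5)).

Definition tder (j : nat) z : tmodel :=
  let y := tadd (tprod z (tadd (tprod (tconst 108) z) (tconst 96))) (tconst 15) in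
  if j is 1%N then topp y else y.

Definition tguess i j : tmodel := TModel (nth [::] (nth [::] branch_coef i) j) 0.

(** Slopes of at least 4 make the error of an approximate root at most a quarter
    of its residual. *)
Definition tbranch i j : tmodel :=
  let z := tguess i j in
  TModel (coefs z)
    (tbound (tadd (tvicsek z) (topp (tpoint i))) / 4 + 1)%BZ.

(** The slope estimate needs the approximate root to be within the piece j,
    which has room for 4/1024 on either side of the interval j. *)
Definition guess_ok i j : bool :=
  (1024 * tbound (tadd (tguess i j) (topp (tfrac (center j) 1024)))
     <=? (radius j + 4) * scale)%BZ.

Definition teigen j z : tmodel :=
  tpoly (eigen j)
    (tprod (tadd (tprod (tconst 1024) z) (tconst (- center j)%BZ)) (tfrac 1 (radius j))).

Definition base i j := nth (1, 1, (0, 0, 0)%N)%BZ (nth [::] base_data i) j.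

(** The v such that the derivative is n/d (1 + v) in absolute value. *)
Definition tquot i j : tmodel :=
  let: (n, d, _) := base i j in
  tadd (tprod (tder j (tbranch i j)) (tfrac d n)) (tconst (-1)%BZ).

Definition base_ok i j : bool :=
  let: (n, d, (a, b, c)) := base i j in
  [&& (0 <? n), (0 <? d),
      (n * (15 ^ Z.of_nat a * 24 ^ Z.of_nat b * 80 ^ Z.of_nat c)
        =? d * (16 ^ Z.of_nat a * 25 ^ Z.of_nat b * 81 ^ Z.of_nat c))
    & (8 * tbound (tquot i j) <=? scale)]%BZ.

Definition tweight A B C i j : tmodel :=
  let: (_, _, (a, b, c)) := base i j in
  tprod (tprod (tprod (tpower A a) (tpower B b)) (tpower C c)) (troot (tquot i j)).

Definition tterm A B C i j : tmodel :=
  tprod (tweight A B C i j) (teigen j (tbranch i j)).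

Definition tdefect A B C i : tmodel :=
  tadd (tadd (tterm A B C i 0) (tadd (tterm A B C i 1) (tterm A B C i 2)))
    (topp (TModel (eigen i) 0)).

Definition eigen_ok i : bool :=
  ((scale <=? 2 * (head Z0 (eigen i) - pnorm (behead (eigen i)))) &&
   (pnorm (eigen i) <=? 2 * scale))%BZ.

Definition certificate A B C : bool :=
  all (fun i => [&& all (guess_ok i) digits, all (base_ok i) digits, eigen_ok i
    & (tbound (tdefect A B C i) <=? 4096)%BZ]) digits.

Definition powA := troot (tfrac 1 15).
Definition powB := troot (tfrac 1 24).
Definition powC := troot (tfrac 1 80).

Lemma certificate_valid : certificate powA powB powC.
Proof. by vm_compute. Qed.

(** * Soundness of the certificate *)

Section Soundness.
Context {R : realType}.
Local Notation zr := (@zr R).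
Local Notation J := (@vicsek_julia R).
Local Notation s := (zr sigma / zr scale).
Local Notation encl := (encl scale).
Implicit Types (x z u : R) (t : tmodel).

Let scale_gt0 : (0 <? scale)%BZ. Proof. by []. Qed.

Let M0 : 0 < zr scale. Proof. by rewrite -zr0 zr_lt. Qed.

Let zr_pos (a : positive) : zr (Zpos a) = (Pos.to_nat a)%:R.
Proof. by rewrite unlock. Qed.

Let z1024 : zr 1024 = 1024. Proof. by rewrite unlock. Qed.
Let z4 : zr 4 = 4. Proof. by rewrite unlock. Qed.

Let encl_coefs p u : encl u (TModel p 0) (peval p u / zr scale).
Proof. by rewrite /encl /= mulrC divfK ?gt_eqF// subrr normr0 zr0. Qed.

Definition local_coordinate j x : R := (1024 * x - zr (center j)) / zr (radius j).

Let radius_gt0 j : (0 <? radius j)%BZ. Proof. by case: j => [|[|j]]. Qed.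

Let encl_point i x : `|local_coordinate i x| <= 1 ->
  encl (local_coordinate i x) (tpoint i) x.
Proof.
set u := local_coordinate i x => u1.
have r0 : zr (radius i) != 0 by rewrite gt_eqF// -zr0 zr_lt.
have -> : x = zr (center i) / zr 1024 + zr (radius i) / zr 1024 * u.
  by rewrite /u /local_coordinate z1024; field.
apply: encl_add; first exact: encl_rat.
apply: encl_mul => //; first exact: encl_rat.
have {2}-> : u = peval [:: Z0; scale] u / zr scale.
  by rewrite /= zr0 mulr0 addr0 add0r mulfK// gt_eqF.
exact: encl_coefs.
Qed.

Let encl_vicsek u t z : `|u| <= 1 -> encl u t z -> encl u (tvicsek t) (vicsek_map z).
Proof.
move=> u1 tz; rewrite /vicsek_map.
have e6 : encl u (tconst 6) (6 : R) by have := encl_int scale_gt0 u 6; rewrite zr_pos.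
have e3 : encl u (tconst 3) (3 : R) by have := encl_int scale_gt0 u 3; rewrite zr_pos.
have e5 : encl u (tconst 5) (5 : R) by have := encl_int scale_gt0 u 5; rewrite zr_pos.
by apply: encl_mul => //; [apply: encl_mul => //|]; apply: encl_add => //;
  exact: encl_mul.
Qed.

Let encl_der u j t z : `|u| <= 1 -> in_piece j z -> encl u t z ->
  encl u (tder j t) `|vicsek_der z|.
Proof.
move=> u1 jz tz.
have e108 : encl u (tconst 108) (108 : R).
  by have := encl_int scale_gt0 u 108; rewrite zr_pos.
have e96 : encl u (tconst 96) (96 : R).
  by have := encl_int scale_gt0 u 96; rewrite zr_pos.
have e15 : encl u (tconst 15) (15 : R).
  by have := encl_int scale_gt0 u 15; rewrite zr_pos.
have derE : vicsek_der z = z * (108 * z + 96) + 15 by rewrite /vicsek_der; ring.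
have e : encl u (tadd (tprod t (tadd (tprod (tconst 108) t) (tconst 96))) (tconst 15))
    (vicsek_der z).
  rewrite derE; apply: encl_add => //; apply: encl_mul => //.
  by apply: encl_add => //; exact: encl_mul.
rewrite /tder; case: j jz => [|[|j]] /= /andP[z1 z2].
- by rewrite ger0_norm// derE; nra.
- by rewrite ltr0_norm; [exact: encl_opp|rewrite derE; nra].
- by rewrite ger0_norm// derE; nra.
Qed.

Let guess_piece u i j : `|u| <= 1 -> guess_ok i j ->
  in_piece j (peval (coefs (tguess i j)) u / zr scale).
Proof.
move=> u1; rewrite /guess_ok.
set z := _ / _; set b := tbound _ => ok.
have : `|zr scale * (z - zr (center j) / zr 1024)| <= zr b.
  apply: (encl_bound u1); apply: encl_add; first exact: encl_coefs.
  by apply: encl_opp; exact: encl_rat.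
rewrite normrM (gtr0_norm M0) z1024 => zb.
have {zb ok} : `|1024 * z - zr (center j)| <= zr (radius j) + 4.
  have r4 : zr (radius j + 4)%BZ = zr (radius j) + 4 by rewrite zrD z4.
  have -> : 1024 * z - zr (center j) = zr 1024 * (z - zr (center j) / zr 1024).
    by rewrite z1024; field.
  move: ok; rewrite -(zr_le (R := R)) !zrM r4 normrM => ok.
  rewrite -(ler_pM2r M0); apply: le_trans ok.
  rewrite z1024 ger0_norm; last by lra.
  rewrite -[leLHS]mulrA; apply: ler_wpM2l; first by lra.
  by rewrite [leLHS]mulrC.
rewrite ler_norml /center /radius; clear b; clearbody z.
case: j => [|[|j]] /=.
- have -> : zr (-892)%BZ = -892 by rewrite unlock.
  have -> : zr 39 = 39 by rewrite unlock.
  by move=> /andP[z1 z2]; apply/andP; split; lra.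
- have -> : zr (-427)%BZ = -427 by rewrite unlock.
  have -> : zr 86 = 86 by rewrite unlock.
  by move=> /andP[z1 z2]; apply/andP; split; lra.
- have -> : zr (-47)%BZ = -47 by rewrite unlock.
  have -> : zr 47 = 47 by rewrite unlock.
  by move=> /andP[z1 z2]; apply/andP; split; lra.
Qed.

(* Both the approximate and the exact root lie in the piece j, where the slope
   of a chord is at least 4. *)
Let encl_branch i j x : `|local_coordinate i x| <= 1 -> x \in `[-1, 0] ->
  guess_ok i j -> encl (local_coordinate i x) (tbranch i j) (branch j x).
Proof.
move=> u1 x01 ok; have jg := guess_piece u1 ok.
have [jz _ zx] := branchP j x01; move: u1 (encl_point u1) jg.
set u := local_coordinate i x => u1 xE jg.
set g := _ / _ in jg.
have gE : encl u (tguess i j) g by exact: encl_coefs.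
have := encl_bound u1 (encl_add (encl_vicsek u1 gE) (encl_opp xE)).
set b := tbound _ => gb.
have zb : zr b / 4 <= zr (b / 4)%BZ + 1.
  by have := @zr_div_ge R b 4; rewrite z4 ltr0n => /(_ isT); lra.
have /andP[slope4 _] := slope_bound jg jz.
rewrite /encl /= zrD zr1; apply: le_trans zb.
have -> : peval (nth [::] (nth [::] branch_coef i) j) u = zr scale * g.
  by rewrite /g mulrC divfK// gt_eqF.
rewrite distrC -mulrBr ler_pdivlMr; last by lra.
apply: le_trans gb.
have -> : vicsek_map g - x = (g - branch j x) * vicsek_slope g (branch j x).
  by rewrite -vicsek_mapB zx.
rewrite mulrA [leRHS]normrM.
by rewrite ler_wpM2l.
Qed.

Definition eigen_value j z : R :=
  peval (eigen j) (local_coordinate j z) / zr scale.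

Let encl_eigen u j t z : `|u| <= 1 -> encl u t z ->
  encl u (teigen j t) (eigen_value j z).
Proof.
move=> u1 tz; apply: encl_horner => //; rewrite /local_coordinate.
have -> : (1024 * z - zr (center j)) / zr (radius j) =
  (zr 1024 * z + zr (- center j)%BZ) * (zr 1 / zr (radius j)).
  by rewrite zr1 mul1r zrN z1024.
apply: encl_mul => //; last exact: encl_rat.
apply: encl_add; last exact: encl_int.
by apply: encl_mul => //; exact: encl_int.
Qed.

Let powRX (a r : R) n : 0 <= a -> (a ^+ n) `^ r = (a `^ r) ^+ n.
Proof.
move=> a0; elim: n => [|n IH]; first by rewrite !expr0 powR1.
by rewrite !exprS powRM ?exprn_ge0// IH.
Qed.

(* The derivative is n/d (1 + v) in absolute value; the power of n/d is a product
   of powers of 16/15, 25/24 and 81/80, and that of 1 + v is a binomial series. *)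
Let encl_weight A B C i j x : `|local_coordinate i x| <= 1 -> x \in `[-1, 0] ->
  let u := local_coordinate i x in
  encl u A ((16 / 15) `^ (- s)) -> encl u B ((25 / 24) `^ (- s)) ->
  encl u C ((81 / 80) `^ (- s)) -> guess_ok i j -> base_ok i j ->
  encl u (tweight A B C i j) (rate j x `^ s).
Proof.
move=> u1 x01 u eA eB eC gok.
have [jz _ _] := branchP j x01.
have yE := encl_der u1 jz (encl_branch u1 x01 gok).
have /andP[y4 _] := slope_bound jz jz; rewrite vicsek_slopexx in y4.
rewrite /base_ok /tweight /tquot; case: (base i j) => -[n d] [[a b] c].
move=> /and4P[n0 d0 /Z.eqb_spec ndE ok]; set y := `|_| in yE y4.
have n0' : 0 < zr n by rewrite -zr0 zr_lt.
have d0' : 0 < zr d by rewrite -zr0 zr_lt.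
set v := y * (zr d / zr n) + zr (-1)%BZ.
have vE : encl u (tadd (tprod (tder j (tbranch i j)) (tfrac d n)) (tconst (-1)%BZ)) v.
  by apply: encl_add; [apply: encl_mul => //; exact: encl_rat|exact: encl_int].
have powv := encl_pow degree scale_gt0 (isT : (0 <? sigma)%BZ)
  (isT : (sigma <? scale)%BZ) order u1 vE ok.
have v1 : 1 + v = y * (zr d / zr n) by rewrite /v unlock; ring.
have nd : zr n / zr d = (16 / 15) ^+ a * (25 / 24) ^+ b * (81 / 80) ^+ c.
  have := congr1 zr ndE; rewrite !zrM !zrX.
  have -> : zr 15 = 15 by rewrite unlock.
  have -> : zr 24 = 24 by rewrite unlock.
  have -> : zr 80 = 80 by rewrite unlock.
  have -> : zr 16 = 16 by rewrite unlock.
  have -> : zr 25 = 25 by rewrite unlock.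
  have -> : zr 81 = 81 by rewrite unlock.
  rewrite !expr_div_n => e.
  have p15 : 15 ^+ a != 0 :> R by rewrite expf_neq0.
  have p24 : 24 ^+ b != 0 :> R by rewrite expf_neq0.
  have p80 : 80 ^+ c != 0 :> R by rewrite expf_neq0.
  apply: (mulIf (mulf_neq0 (mulf_neq0 p15 p24) p80)).
  rewrite mulrAC e; move: p15 p24 p80 (lt0r_neq0 d0').
  by move: (15 ^+ a) (24 ^+ b) (80 ^+ c) (zr d) => p q r D *; field; do ?[apply/andP; split].
have -> : rate j x `^ s = (16 / 15) `^ (- s) ^+ a * (25 / 24) `^ (- s) ^+ b *
    (81 / 80) `^ (- s) ^+ c * (1 + v) `^ (- s).
  rewrite /rate -/y -[y^-1]powR_inv1; last by lra.
  rewrite -powRrM mulN1r.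
  have {1}-> : y = zr n / zr d * (1 + v).
    by rewrite v1; field; rewrite !gt_eqF.
  rewrite nd -!powRX ?divr_ge0// !powRM ?mulr_ge0 ?exprn_ge0 ?divr_ge0//.
  by rewrite v1 mulr_ge0 ?divr_ge0 ?ltW//; lra.
by apply: encl_mul => //; apply: encl_mul => //; [apply: encl_mul => //|];
  exact: encl_exp.
Qed.

Definition test_function x : R :=
  if in_piece 0 x then eigen_value 0 x
  else if in_piece 1 x then eigen_value 1 x else eigen_value 2 x.

Let test_functionE j x : j \in digits -> in_piece j x ->
  test_function x = eigen_value j x.
Proof.
rewrite /test_function !inE => /or3P[] /eqP -> /= jx; first by rewrite jx.
- rewrite jx ifF//; apply/negP; move: jx => /andP[? ?] /andP[? ?]; lra.
- by rewrite !ifF//; apply/negP; move: jx => /andP[? ?] /andP[? ?]; lra.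
Qed.

Let julia_piece x : J x -> exists i, [/\ i \in digits, in_piece i x &
  `|local_coordinate i x| <= 1].
Proof.
move=> /julia_preimage[i [y [idg Jy ->]]]; exists i.
have y01 := julia_itv Jy; have [iz _ zy] := branchP i y01; split=> //.
have r0 : 0 < zr (radius i) by rewrite -zr0 zr_lt.
rewrite /local_coordinate normrM normfV (gtr0_norm r0) ler_pdivrMr// mul1r.
move: y01 iz zy; rewrite in_itv /=; move: (branch i y) => z y01 iz zy.
move: y01; rewrite -zy /vicsek_map => /andP[m1 m0] {r0 zy}.
have m1' : 0 <= (3 * z + 1) * (12 * z ^+ 2 + 12 * z + 1).
  by move: m1; nra.
move: idg; rewrite !inE ler_norml => /or3P[] /eqP iE; rewrite iE /= in iz *;
  case/andP: iz => z1 z2; rewrite /center /radius.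
- have -> : zr (-892)%BZ = -892 by rewrite unlock.
  have -> : zr 39 = 39 by rewrite unlock.
  apply/andP; split; rewrite leNgt; apply/negP => h.
    have : 0 <= (- (931 / 1024) - z) * (- (z - 931 / 1024 + 1)).
      by apply: mulr_ge0; lra.
    move=> q; have : 0 < (- (3 * z + 1)) * (12 * z ^+ 2 + 12 * z + 1).
      by apply: mulr_gt0; lra.
    lra.
  have : 0 < (- z) * (- (6 * z + 3)) * (6 * z + 5) by do 2?apply: mulr_gt0; lra.
  lra.
- have -> : zr (-427)%BZ = -427 by rewrite unlock.
  have -> : zr 86 = 86 by rewrite unlock.
  apply/andP; split; rewrite leNgt; apply/negP => h.
    have : 0 < (- z) * (- (6 * z + 3)) * (6 * z + 5) by do 2?apply: mulr_gt0; lra.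
    lra.
  have q : 0 <= (z + 1 / 2) * (- (8 / 25) - z) by apply: mulr_ge0; lra.
  have : 0 < (3 * z + 1) * (- (12 * z ^+ 2 + 12 * z + 1)).
    by apply: mulr_gt0; lra.
  lra.
- have -> : zr (-47)%BZ = -47 by rewrite unlock.
  have -> : zr 47 = 47 by rewrite unlock.
  apply/andP; split; rewrite leNgt; apply/negP => h.
    have q : 0 <= (z + 1 / 10) * (- (94 / 1024) - z) by apply: mulr_ge0; lra.
    have : 0 < (3 * z + 1) * (- (12 * z ^+ 2 + 12 * z + 1)).
      by apply: mulr_gt0; lra.
    lra.
  have : 0 < z * (6 * z + 3) * (6 * z + 5) by do 2?apply: mulr_gt0; lra.
  lra.
Qed.

Let eigen_bound i x : `|local_coordinate i x| <= 1 -> eigen_ok i ->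
  2^-1 <= eigen_value i x <= 2.
Proof.
move=> u1; rewrite /eigen_ok /eigen_value; move: (local_coordinate i x) u1 => u u1.
move=> /andP[lo hi]; rewrite ler_pdivlMr// ler_pdivrMr//.
have z2 : zr 2 = 2 by rewrite unlock.
have := peval_norm (eigen i) u1; rewrite ler_norml => /andP[_ up].
have := peval_norm (behead (eigen i)) u1; rewrite ler_norml => /andP[tlo _].
move: lo hi; rewrite -!(zr_le (R := R)) !zrM zrD zrN z2 => lo hi.
apply/andP; split; last exact: le_trans up hi.
have : zr (head Z0 (eigen i)) - zr (pnorm (behead (eigen i))) <= peval (eigen i) u.
  case: (eigen i) u1 tlo => [|a p] u1 tlo /=; first by rewrite subrr.
  have : `|u * peval p u| <= zr (pnorm p).
    by rewrite normrM (le_trans _ (peval_norm p u1))// ler_piMl.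
  by rewrite ler_norml => /andP[? _]; lra.
by move=> h; rewrite mulrC ler_pdivrMr//; lra.
Qed.

Let certificateP A B C i j : certificate A B C -> i \in digits -> j \in digits ->
  [/\ guess_ok i j, base_ok i j, eigen_ok i & (tbound (tdefect A B C i) <=? 4096)%BZ].
Proof.
rewrite /certificate => /allP h id jd; have /and4P[/allP g /allP b e d] := h i id.
by split; [exact: g|exact: b|exact: e|exact: d].
Qed.

Let unit_powers u : `|u| <= 1 ->
  [/\ encl u powA ((16 / 15) `^ (- s)), encl u powB ((25 / 24) `^ (- s)) &
      encl u powC ((81 / 80) `^ (- s))].
Proof.
move=> u1.
have pow n : (0 <? n)%BZ -> (8 * tbound (tfrac 1 n) <=? scale)%BZ ->
    encl u (troot (tfrac 1 n)) ((1 + zr 1 / zr n) `^ (- s)).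
  by move=> n0 ok; apply: encl_pow => //; exact: encl_rat.
have z15 : zr 15 = 15 by rewrite unlock.
have z24 : zr 24 = 24 by rewrite unlock.
have z80 : zr 80 = 80 by rewrite unlock.
split.
- have -> : 16 / 15 = 1 + zr 1 / zr 15 by rewrite zr1 z15; field.
  exact: pow.
- have -> : 25 / 24 = 1 + zr 1 / zr 24 by rewrite zr1 z24; field.
  exact: pow.
- have -> : 81 / 80 = 1 + zr 1 / zr 80 by rewrite zr1 z80; field.
  exact: pow.
Qed.

Lemma test_function_bound x : J x -> 2^-1 <= test_function x <= 2.
Proof.
move=> /julia_piece[i [idg ix u1]]; rewrite (test_functionE idg ix).
by have [_ _ ok _] := certificateP certificate_valid idg idg; exact: eigen_bound.
Qed.

(** The certificate bounds the error by 4096/scale, which is relative to values of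
    at least 1/2 of the test function. *)
Definition defect : R := 2 * (zr 4096 / zr scale).

Lemma defect_ge0 : 0 <= defect.
Proof.
have e0 : 0 <= zr 4096 by rewrite -zr0 zr_le.
exact: mulr_ge0 (ler0n _ 2) (divr_ge0 e0 (ltW M0)).
Qed.

Lemma test_function_defect x : J x ->
  `|transfer s test_function x - test_function x| <= defect * test_function x.
Proof.
move=> Jx; have x01 := julia_itv Jx; have [i [idg ix u1]] := julia_piece Jx.
have /andP[f1 _] := test_function_bound Jx.
have [eA eB eC] := unit_powers u1.
set u := local_coordinate i x in u1 eA eB eC.
have term j : j \in digits ->
    encl u (tterm powA powB powC i j) (rate j x `^ s * test_function (branch j x)).
  move=> jdg; have [g b _ _] := certificateP certificate_valid idg jdg.
  have [jz _ _] := branchP j x01; rewrite (test_functionE jdg jz).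
  apply: encl_mul => //; first exact: encl_weight.
  by apply: encl_eigen => //; exact: encl_branch.
have sum : transfer s test_function x =
    rate 0 x `^ s * test_function (branch 0 x) +
    (rate 1 x `^ s * test_function (branch 1 x) +
     rate 2 x `^ s * test_function (branch 2 x)).
  by rewrite /transfer /digits !big_cons big_nil addr0.
have dE : encl u (tdefect powA powB powC i)
    (transfer s test_function x - test_function x).
  rewrite sum (test_functionE idg ix); apply: encl_add.
    by apply: encl_add; [exact: term|apply: encl_add; exact: term].
  by apply: encl_opp; exact: encl_coefs.
have [_ _ _ small] := certificateP certificate_valid idg idg.
have := encl_bound u1 dE; rewrite -(zr_le (R := R)) in small.
move=> /le_trans /(_ small); rewrite normrM (gtr0_norm M0) => le.
have {le} : `|transfer s test_function x - test_function x| <= zr 4096 / zr scale.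
  by rewrite ler_pdivlMr// mulrC.
have := defect_ge0; rewrite /defect; move: (zr 4096 / zr scale) => e e0 le.
by apply: le_trans le _; nra.
Qed.

End Soundness.

(** * The decimals of the dimension *)

Section Decimals.
Context {R : realType}.
Local Notation zr := (@zr R).
Local Notation s := (zr sigma / zr scale).

Definition decimal_numerator (ds : seq nat) : Z :=
  foldl (fun a d => 10 * a + Z.of_nat d)%BZ Z0 ds.

Lemma decimalE (ds : seq nat) :
  decimal R ds = zr (decimal_numerator ds) / zr (10 ^ Z.of_nat (size ds))%BZ.
Proof.
have z10 : zr 10 = 10 by rewrite unlock.
rewrite zrX z10; elim/last_ind: ds => [|ds d IH].
  by rewrite /decimal big_ord0 zr0 mul0r.
have -> : decimal R (rcons ds d) = decimal R ds + d%:R / 10 ^+ (size ds).+1.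
  rewrite /decimal size_rcons big_ord_recr /= nth_rcons ltnn eqxx; congr (_ + _).
  by apply: eq_bigr => i _; rewrite nth_rcons ltn_ord.
rewrite IH /decimal_numerator foldl_rcons -/(decimal_numerator ds) zrD zrM zr_nat.
by rewrite size_rcons z10 exprS; field; rewrite expf_neq0.
Qed.

(** The hypotheses are the conclusions, multiplied by the denominators: they
    compare integers and can be computed. *)
Lemma exponent_margins (l h T : Z) : (0 <? T)%BZ ->
  (16 * 4096 * T + 3 * (l * scale) <? 3 * (sigma * T))%BZ ->
  (sigma * T <=? scale * T)%BZ -> (0 <? l)%BZ ->
  (8 * 4096 * T + 3 * (sigma * T) <? 3 * (h * scale))%BZ ->
  [/\ 0 < zr l / zr T, 2 * defect < 3 / 4 * (s - zr l / zr T),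
      s - zr l / zr T <= 1 & defect < 3 / 4 * (zr h / zr T - s)].
Proof.
have M0 : 0 < zr scale by rewrite -(zr0 (R := R)) zr_lt.
rewrite -!(zr_lt (R := R)) -(zr_le (R := R)) !zrD !zrM zr0 /defect.
have -> : zr 16 = 16 by rewrite unlock.
have -> : zr 8 = 8 by rewrite unlock.
have -> : zr 3 = 3 by rewrite unlock.
move: (zr scale) (zr sigma) (zr T) (zr l) (zr h) (zr 4096) M0.
move=> M g t p q e M0 t0 low gM p0 high; have MT0 : 0 < M * t by exact: mulr_gt0.
have M1 : M != 0 by rewrite gt_eqF. have t1 : t != 0 by rewrite gt_eqF.
split; first exact: divr_gt0.
- rewrite -subr_gt0 [ltRHS](_ : _ =
    (3 * (g * t) - (16 * e * t + 3 * (p * M))) / (4 * (M * t))).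
    by rewrite divr_gt0//; lra.
  by field; apply/andP.
- rewrite (le_trans (_ : _ <= g / M))//; first by rewrite gerBl ltW// divr_gt0.
  by rewrite ler_pdivrMr// mul1r -(ler_pM2r t0).
- rewrite -subr_gt0 [ltRHS](_ : _ =
    (3 * (q * M) - (8 * e * t + 3 * (g * t))) / (4 * (M * t))).
    by rewrite divr_gt0//; lra.
  by field; apply/andP.
Qed.

End Decimals.

Theorem theorem3p8 (R : realType) :
  (((decimal R [:: 4; 9; 1; 9; 5; 4; 5; 7; 0; 0; 5; 2; 6; 6]%N)%:E
      <= hausdorff_dim (@vicsek_julia R)) /\
   (hausdorff_dim (@vicsek_julia R)
      <= (decimal R [:: 4; 9; 1; 9; 5; 4; 5; 7; 0; 0; 5; 2; 6; 7]%N)%:E))%E.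
Proof.
rewrite !decimalE; set l := decimal_numerator _; set h := decimal_numerator _.
set T := (10 ^ _)%BZ.
have low_margin : (16 * 4096 * T + 3 * (l * scale) <? 3 * (sigma * T))%BZ.
  by vm_compute.
have high_margin : (8 * 4096 * T + 3 * (sigma * T) <? 3 * (h * scale))%BZ.
  by vm_compute.
have [lo_gt0 low le1 high] :=
  @exponent_margins R l h T isT low_margin isT isT high_margin.
clear low_margin high_margin.
have half_gt0 : 0 < 2^-1 :> R by lra.
exact: (transfer_dim_enclosure half_gt0 test_function_bound defect_ge0 lo_gt0
  low le1 high test_function_defect).
Qed.
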